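(* Let $M$ be the surface of a cube in $\mathbb{R}^3$ (side length $L>0$). Then for every point $P\in M$ (corners of the cube allowed) the wave front $W_t(P)$ becomes dense on $M$. That is, for every $P\in M$ and every $r>0$ there is a time $\tau(P,r)$ such that for all $t>\tau(P,r)$ and all $Q\in M$ one has $W_t(P)\cap B_r(Q)\neq\emptyset$.
   Context: The surface $M$ of the cube (the union of its six square faces) carries the intrinsic piecewise flat metric, which is a flat Riemannian metric away from the eight corners (vertices). Geodesics on $M$ are unit speed curves that are straight line segments inside the faces and that cross an edge so as to become a straight line when the two adjacent faces are unfolded into a common plane. A geodesic that runs into a corner is not continued past it; such trajectories are disregarded. For $P\in M$ and $t>0$, the wave front $W_t(P)$ is the set of endpoints $x(t)$ of all unit speed geodesics $x:[0,t]\to M$ with $x(0)=P$ that do not meet a corner of the cube at any time in $(0,t]$ (all initial directions at $P$ are allowed; if $P$ is a corner, these are the directions from $P$ into the three faces meeting at $P$, of total angle $3\pi/2$). For $Q\in M$ and $r>0$, $B_r(Q)$ is the open ball of radius $r$ around $Q$ in the intrinsic distance of $M$. The wave front $W_t(P)$ is said to become dense on $M$ if for every open ball $B_r(Q)$ with $r>0$ there is a time $\tau(P,r)$ (depending on $P$ and $r$ but not on $Q$) such that $W_t(P)\cap B_r(Q)\ne\emptyset$ for all $t>\tau(P,r)$. *)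

(* Defs.v *)
From HB Require Import structures.
From mathcomp Require Import all_boot all_order all_algebra.
From mathcomp Require Import all_classical all_reals all_analysis.

Set Implicit Arguments.
Unset Strict Implicit.
Unset Printing Implicit Defensive.

Import Order.TTheory GRing.Theory Num.Theory.
Import numFieldNormedType.Exports.

Local Open Scope classical_set_scope.
Local Open Scope ring_scope.

(* The norm that the library puts on matrices is the max norm. *)
Definition euclid_norm (R : realType) (v : 'rV[R]_3) : R :=
  Num.sqrt (\sum_i v 0 i ^+ 2).

(* The cube of side length [side] in arbitrary position: [origin] is one of
   its corners, and the rows of [axes] are the unit directions of the three
   edges that start there. *)
Record cube (R : realType) := Cube {
  origin : 'rV[R]_3;
  axes : 'M[R]_3;
  side : R;
  axes_orthonormal : axes *m axes^T = 1%:M;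
  side_gt0 : 0 < side }.

Section CubeSurface.
Context {R : realType} (C : cube R).
Implicit Types (p q : 'rV[R]_3) (t : R) (x : R -> 'rV[R]_3).

Definition cube_coord p (i : 'I_3) : R := ((p - origin C) *m (axes C)^T) 0 i.

(* The pair (i, b) names the face on which the i-th coordinate is [side] if b,
   and 0 otherwise. *)
Definition face_index := ('I_3 * bool)%type.

Definition face (F : face_index) : set 'rV[R]_3 :=
  [set p | (forall j, 0 <= cube_coord p j <= side C) /\
           cube_coord p F.1 = if F.2 then side C else 0].

Definition surface : set 'rV[R]_3 := [set p | exists F, face F p].

Definition corners : set 'rV[R]_3 :=
  [set p | forall i, cube_coord p i = 0 \/ cube_coord p i = side C].

Definition outer_normal (F : face_index) : 'rV[R]_3 :=
  (if F.2 then 1 else -1) *: row F.1 (axes C).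

(* Distance to the plane of F, for a point of the cube. *)
Definition depth (F : face_index) p : R :=
  if F.2 then side C - cube_coord p F.1 else cube_coord p F.1.

(* For adjacent faces F and G (F.1 != G.1), the restriction of [develop F G] to
   F `|` G develops these two faces into the plane of F. It is the identity on
   F, where the depth vanishes. A point p of G at depth d has the foot
   q = p + d *: outer_normal F on the common edge, and the rotation of G about
   that edge sends it to q + d *: outer_normal G. *)
Definition develop (F G : face_index) p : 'rV[R]_3 :=
  p + depth F p *: (outer_normal F + outer_normal G).

(* Each time in [0, t] has a neighbourhood in [0, t] during which x stays in
   two adjacent faces (possibly in just one of them) and becomes a unit speed
   straight line once these are unfolded. The values of x outside [0, t] play
   no role. Corners are not excluded here. *)
Definition geodesic t x : Prop :=
  forall s, 0 <= s <= t ->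
  exists e : R, 0 < e /\
  exists F G : face_index, F.1 != G.1 /\
  exists a v : 'rV[R]_3, euclid_norm v = 1 /\
  forall u, 0 <= u <= t -> `|u - s| < e ->
    (face F `|` face G) (x u) /\ develop F G (x u) = a + u *: v.

Definition wave_front t p : set 'rV[R]_3 :=
  [set q | exists x, [/\ geodesic t x, x 0 = p,
                         forall s, 0 < s <= t -> ~ corners (x s) & x t = q]].

Definition curve_length (c : R -> 'rV[R]_3) : \bar R :=
  ereal_sup [set (\sum_(0 <= n < size s)
                    euclid_norm (c (nth 1 (0 :: s) n.+1) -
                                 c (nth 1 (0 :: s) n)))%:E
            | s in itv_partition 0 1].

Definition surface_path p q (c : R -> 'rV[R]_3) : Prop :=
  [/\ {within `[0, 1], continuous c}, c 0 = p, c 1 = q &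
      forall s, 0 <= s <= 1 -> surface (c s)].

Definition intrinsic_dist p q : \bar R :=
  ereal_inf [set curve_length c | c in surface_path p q].

Definition intrinsic_ball q (r : R) : set 'rV[R]_3 :=
  [set p | surface p /\ (intrinsic_dist q p < r%:E)%E].

Definition wave_front_becomes_dense p : Prop :=
  forall r : R, 0 < r ->
  exists tau : R, 0 < tau /\
  forall t, tau < t -> forall q, surface q ->
    wave_front t p `&` intrinsic_ball q r !=set0.

End CubeSurface.

(* Main.v *)
Require Import Defs.
From mathcomp Require Import all_boot all_order all_algebra.
From mathcomp Require Import all_classical all_reals all_analysis.
From mathcomp Require Import ring lra zify.

(* Unfolding the cube along a geodesic amounts to rolling it on the squared
   plane; a step to the right and a step up both have order 4. Take lines
   through P of slope N + 1 / S with 4 | N. Since N steps up cancel, the cube at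
   the end of such a line is determined by the few columns, about S apart, in
   which an additional step up occurs, and by the position modulo 4 of the final
   square. For a fixed large N and large t, the end points at distance
   t form almost a straight line of bounded length in the direction (-N, 1),
   which modulo 4 comes close to every point. A bounded change of S does not
   move the end point much, but it changes the columns modulo 4: taking S near
   an even number makes the additional steps cancel in blocks of four, except
   for the last one, whose column modulo 4 can be prescribed. One quarter turn
   of prescribed direction suffices to bring any of the six faces to the
   bottom. *)

Set Implicit Arguments.
Unset Strict Implicit.
Unset Printing Implicit Defensive.

Import Order.TTheory GRing.Theory Num.Theory.
Import numFieldNormedType.Exports.

Local Open Scope classical_set_scope.
Local Open Scope ring_scope.

(** * Rolling the cube *)

(* A corner of the cube, with an order on the three edges at this corner: the
   axes [xaxis] and [yaxis] span the face on which the cube stands, [zaxis] is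
   orthogonal to it. The coordinate [i] of the corner is [side] if
   [corner_bit i], and 0 otherwise. *)
Record frame := Frame {
  xaxis : 'I_3; yaxis : 'I_3; zaxis : 'I_3; corner_bit : 'I_3 -> bool }.

(** The cube tips over the far edge of its base: the face beyond that edge becomes the base, the old
    [zaxis] becomes horizontal, and the reference corner moves along [xaxis], which flips one
    bit. *)
Definition roll_right (f : frame) :=
  Frame (zaxis f) (yaxis f) (xaxis f)
    (fun i => corner_bit f i (+) (i == xaxis f)).

Definition roll_up (f : frame) :=
  Frame (xaxis f) (zaxis f) (yaxis f)
    (fun i => corner_bit f i (+) (i == yaxis f)).

Definition proper_frame (f : frame) :=
  [/\ xaxis f != yaxis f, xaxis f != zaxis f & yaxis f != zaxis f].

Definition base_face (f : frame) : face_index :=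
  (zaxis f, corner_bit f (zaxis f)).

Lemma proper_roll_right f : proper_frame f -> proper_frame (roll_right f).
Proof. by case=> xy xz yz; split=> //=; rewrite eq_sym. Qed.

Lemma proper_roll_up f : proper_frame f -> proper_frame (roll_up f).
Proof. by case=> xy xz yz; split=> //=; rewrite eq_sym. Qed.

Lemma proper_iter_right n f :
  proper_frame f -> proper_frame (iter n roll_right f).
Proof. by move=> pf; elim: n => //= n; exact: proper_roll_right. Qed.

Lemma proper_iter_up n f : proper_frame f -> proper_frame (iter n roll_up f).
Proof. by move=> pf; elim: n => //= n; exact: proper_roll_up. Qed.

Lemma roll_right4 f : iter 4 roll_right f = f.
Proof.
case: f => x y z b; congr Frame; apply/funext => i /=.
by case: (b i); case: (i == x); case: (i == z).
Qed.

Lemma roll_up4 f : iter 4 roll_up f = f.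
Proof.
case: f => x y z b; congr Frame; apply/funext => i /=.
by case: (b i); case: (i == y); case: (i == z).
Qed.

(** Two rolls to the right make a half turn, which reverses the sense of a roll up; the second roll
    up therefore undoes the first. *)
Lemma up_right2_up f :
  roll_up (iter 2 roll_right (roll_up f)) = iter 2 roll_right f.
Proof.
case: f => x y z b; congr Frame; apply/funext => i /=.
by case: (b i); case: (i == x); case: (i == y); case: (i == z).
Qed.

Lemma iter_period4 (T : Type) (g : T -> T) (g4 : forall a, iter 4 g a = a)
    (m n : nat) (a : T) : (m = n %[mod 4])%N -> iter m g a = iter n g a.
Proof.
have red k : iter k g a = iter (k %% 4)%N g a.
  rewrite {1}(divn_eq k 4) addnC iterD; congr (iter _ g _).
  by elim: (k %/ 4)%N => [|q IHq]; rewrite ?mul0n// mulSn iterD g4.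
by move=> mn; rewrite red mn -red.
Qed.

Lemma iter_right_mod m n f : (m = n %[mod 4])%N ->
  iter m roll_right f = iter n roll_right f.
Proof. exact/iter_period4/roll_right4. Qed.

Lemma iter_up_mod m n f : (m = n %[mod 4])%N ->
  iter m roll_up f = iter n roll_up f.
Proof. exact/iter_period4/roll_up4. Qed.

Lemma ord3_frame f (i : 'I_3) : proper_frame f ->
  [|| i == xaxis f, i == yaxis f | i == zaxis f].
Proof.
case: f => x y z b [/= xy xz yz].
by apply: contraT; move: xy xz yz; case: x => [[|[|[|?]]] ?] //;
    case: y => [[|[|[|?]]] ?] //; case: z => [[|[|[|?]]] ?] //;
    case: i => [[|[|[|?]]] ?].
Qed.

(** After the step up, steps to the right run through the four faces parallel to the current
    [yaxis]. For [k = 0] this axis is [zaxis f], which leaves out only the two faces orthogonal to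
    it; [k = 1] reaches those. *)
Lemma face_reached f (F : face_index) : proper_frame f ->
  exists k l : nat,
    base_face (iter l roll_right (roll_up (iter k roll_right f))) = F.
Proof.
case: F => i c pf; have /= := ord3_frame i pf.
case: f pf => x y z b [/= xy xz yz].
have yx : y != x by rewrite eq_sym.
have zx : z != x by rewrite eq_sym.
have zy : z != y by rewrite eq_sym.
case/or3P => /eqP->.
- case: (boolP (b x == c)) => [/eqP<-|bc].
    exists 0%N, 3%N; rewrite /base_face /= ?eqxx (negbTE xy).
    by congr pair; case: (b x).
  exists 0%N, 1%N; rewrite /base_face /= ?eqxx (negbTE xy) addbF.
  by congr pair; move: bc; case: (b x); case: c.
- case: (boolP (b y == c)) => [/eqP<-|bc].
    exists 0%N, 2%N; rewrite /base_face /= ?eqxx (negbTE yx).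
    by congr pair; case: (b y).
  exists 0%N, 0%N; rewrite /base_face /= ?eqxx.
  by congr pair; move: bc; case: (b y); case: c.
- case: (boolP (b z == c)) => [/eqP<-|bc].
    exists 1%N, 3%N; rewrite /base_face /= ?eqxx (negbTE zx) (negbTE zy).
    by congr pair; case: (b z).
  exists 1%N, 1%N; rewrite /base_face /= ?eqxx (negbTE zx) (negbTE zy).
  by congr pair; move: bc; case: (b z); case: c.
Qed.

(** * Folding the plane onto the cube *)

(** The offsets are measured from the reference corner into the base face, hence the reversal where
    the bit is set. *)
Definition unit_point (R : realType) (f : frame) (x y : R) : 'rV[R]_3 :=
  \row_i (if i == xaxis f then (if corner_bit f i then 1 - x else x)
          else if i == yaxis f then (if corner_bit f i then 1 - y else y)
          else (corner_bit f i)%:R).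

Definition unit_vector (R : realType) (f : frame) (x y : R) : 'rV[R]_3 :=
  \row_i (if i == xaxis f then (if corner_bit f i then - x else x)
          else if i == yaxis f then (if corner_bit f i then - y else y)
          else 0).

Definition place (R : realType) (C : cube R) (w : 'rV[R]_3) : 'rV[R]_3 :=
  origin C + side C *: (w *m axes C).

Definition fold_point (R : realType) (C : cube R) (f : frame) (x y : R) :=
  place C (unit_point f x y).

Lemma cube_coord_place (R : realType) (C : cube R) (w : 'rV[R]_3) i :
  cube_coord C (place C w) i = side C * w 0 i.
Proof.
rewrite /cube_coord /place addrC addKr -scalemxAl -mulmxA.
by rewrite axes_orthonormal mulmx1 mxE.
Qed.

Lemma place_cube_coord (R : realType) (C : cube R) p (w : 'rV[R]_3) :
  (forall i, cube_coord C p i = side C * w 0 i) -> p = place C w.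
Proof.
move=> h; rewrite /place.
have -> : side C *: (w *m axes C) = (\row_i cube_coord C p i) *m axes C.
  by rewrite scalemxAl; congr (_ *m _); apply/rowP => i; rewrite !mxE h.
have -> : \row_i cube_coord C p i = (p - origin C) *m (axes C)^T.
  by apply/rowP => i; rewrite mxE.
rewrite -mulmxA (mulmx1C (axes_orthonormal C)) mulmx1.
by rewrite addrC subrK.
Qed.

Lemma euclid_norm_mul_axes (R : realType) (C : cube R) (w : 'rV[R]_3) :
  euclid_norm (w *m axes C) = euclid_norm w.
Proof.
have nE (v : 'rV[R]_3) : \sum_i v 0 i ^+ 2 = (v *m v^T) 0 0.
  by rewrite mxE; apply: eq_bigr => i _; rewrite mxE expr2.
rewrite /euclid_norm !nE trmx_mul -mulmxA (mulmxA (axes C)).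
by rewrite axes_orthonormal mul1mx.
Qed.

Lemma euclid_normZ (R : realType) (a : R) (v : 'rV[R]_3) :
  euclid_norm (a *: v) = `|a| * euclid_norm v.
Proof.
rewrite /euclid_norm (eq_bigr (fun i => a ^+ 2 * v 0 i ^+ 2)) => [|i _].
  by rewrite -big_distrr /= sqrtrM ?sqr_ge0// sqrtr_sqr.
by rewrite mxE exprMn.
Qed.

Lemma sum_frame (R : realType) f (F : 'I_3 -> R) : proper_frame f ->
  \sum_i F i = F (xaxis f) + F (yaxis f) + F (zaxis f).
Proof.
move=> pf; have [xy xz yz] := pf.
rewrite (bigD1 (xaxis f))//= (bigD1 (yaxis f)) 1?eq_sym//=.
rewrite (bigD1 (zaxis f)) ?[zaxis f == _]eq_sym ?xz ?yz//=.
rewrite big1 ?addr0 ?addrA// => i /andP[/andP[ix iy] iz].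
by have := ord3_frame i pf; rewrite (negbTE ix) (negbTE iy) (negbTE iz).
Qed.

Lemma euclid_norm_unit_vector (R : realType) f (x y : R) : proper_frame f ->
  euclid_norm (unit_vector f x y) = Num.sqrt (x ^+ 2 + y ^+ 2).
Proof.
move=> pf; have [xy xz yz] := pf.
rewrite /euclid_norm (sum_frame _ pf) !mxE !eqxx.
rewrite ![yaxis f == _]eq_sym ![zaxis f == _]eq_sym.
rewrite (negbTE xy) (negbTE xz) (negbTE yz).
by case: ifP => _; case: ifP => _; rewrite ?sqrrN expr0n addr0.
Qed.

Lemma fold_pointD (R : realType) (C : cube R) f (x y u v s : R) :
  fold_point C f (x + s * u) (y + s * v) =
  fold_point C f x y + s *: (side C *: (unit_vector f u v *m axes C)).
Proof.
rewrite /fold_point /place -addrA; congr (_ + _).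
rewrite [s *: _]scalerA.
rewrite (mulrC s (side C)) -scalerA -scalerDr; congr (_ *: _).
rewrite scalemxAl -mulmxDl; congr (_ *m _); apply/rowP => i; rewrite !mxE.
by do 2 (case: ifP => _; first by case: ifP => _ //; ring); ring.
Qed.

Lemma face_fold_point (R : realType) (C : cube R) f (x y : R) :
  proper_frame f -> 0 <= x <= 1 -> 0 <= y <= 1 ->
  face C (base_face f) (fold_point C f x y).
Proof.
move=> [xy xz yz] x01 y01; have L0 := side_gt0 C; split.
  move=> i; rewrite cube_coord_place.
  have /andP[w0 w1] : 0 <= unit_point f x y 0 i <= 1.
    rewrite mxE; do 2 (case: ifP => _; first by case: ifP => _; lra).
    by case: corner_bit => /=; lra.
  by apply/andP; split; [exact: mulr_ge0 (ltW L0) w0|exact: ler_piMr (ltW L0) w1].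
rewrite cube_coord_place mxE /= ![zaxis f == _]eq_sym.
rewrite (negbTE xz) (negbTE yz).
by case: corner_bit => /=; rewrite ?mulr1 ?mulr0.
Qed.

Lemma depth_fold_point (R : realType) (C : cube R) f (x y : R) :
  proper_frame f -> depth C (base_face f) (fold_point C f x y) = 0.
Proof.
move=> [xy xz yz]; rewrite /depth cube_coord_place mxE /=.
rewrite ![zaxis f == _]eq_sym (negbTE xz) (negbTE yz).
by case: corner_bit => /=; rewrite ?mulr1 ?mulr0 ?subrr.
Qed.

Lemma develop_base (R : realType) (C : cube R) f G (x y : R) :
  proper_frame f ->
  develop C (base_face f) G (fold_point C f x y) = fold_point C f x y.
Proof. by move=> pf; rewrite /develop depth_fold_point// scale0r addr0. Qed.

Lemma develop_place (R : realType) (C : cube R) F G (w : 'rV[R]_3) (d : R) :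
  depth C F (place C w) = side C * d ->
  develop C F G (place C w) =
  place C (w + d *: ((if F.2 then 1 else -1) *: delta_mx 0 F.1 +
                     (if G.2 then 1 else -1) *: delta_mx 0 G.1)).
Proof.
move=> dE; rewrite /develop dE /outer_normal /place !rowE -addrA.
congr (_ + _); rewrite -scalerA -scalerDr; congr (_ *: _).
by rewrite mulmxDl -scalemxAl mulmxDl -!scalemxAl.
Qed.

Lemma develop_roll_right (R : realType) (C : cube R) f (x y : R) :
  proper_frame f ->
  develop C (base_face f) (base_face (roll_right f))
    (fold_point C (roll_right f) x y) = fold_point C f (1 + x) y.
Proof.
move=> pf; have [xy xz yz] := pf.
have yx : yaxis f != xaxis f by rewrite eq_sym.
have zx : zaxis f != xaxis f by rewrite eq_sym.
have zy : zaxis f != yaxis f by rewrite eq_sym.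
(* The first axis of the rolled frame is [zaxis f], so [x] is the depth below the base face of [f],
   in units of the side. *)
rewrite /fold_point (@develop_place _ _ _ _ _ x).
  congr place; apply/rowP => i; rewrite !mxE /= !eqxx /=.
  have /or3P[] := ord3_frame i pf => /eqP->;
    rewrite ?eqxx ?(negbTE xy) ?(negbTE xz) ?(negbTE yz) ?(negbTE yx)
      ?(negbTE zx) ?(negbTE zy) /= ?addbF ?addbT;
    by case: (corner_bit f (xaxis f)); case: (corner_bit f (yaxis f));
      case: (corner_bit f (zaxis f)) => /=; ring.
rewrite /depth cube_coord_place !mxE /= eqxx (negbTE zx) addbF.
by case: corner_bit; ring.
Qed.

Lemma develop_roll_up (R : realType) (C : cube R) f (x y : R) :
  proper_frame f ->
  develop C (base_face f) (base_face (roll_up f))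
    (fold_point C (roll_up f) x y) = fold_point C f x (1 + y).
Proof.
move=> pf; have [xy xz yz] := pf.
have yx : yaxis f != xaxis f by rewrite eq_sym.
have zx : zaxis f != xaxis f by rewrite eq_sym.
have zy : zaxis f != yaxis f by rewrite eq_sym.
rewrite /fold_point (@develop_place _ _ _ _ _ y).
  congr place; apply/rowP => i; rewrite !mxE /= !eqxx /=.
  have /or3P[] := ord3_frame i pf => /eqP->;
    rewrite ?eqxx ?(negbTE xy) ?(negbTE xz) ?(negbTE yz) ?(negbTE yx)
      ?(negbTE zx) ?(negbTE zy) /= ?addbF ?addbT;
    by case: (corner_bit f (xaxis f)); case: (corner_bit f (yaxis f));
      case: (corner_bit f (zaxis f)) => /=; ring.
rewrite /depth cube_coord_place !mxE /= eqxx (negbTE zx) (negbTE zy) addbF.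
by case: corner_bit; ring.
Qed.

(** With half-open cells, a line in the plane runs into a corner of the cube only at a lattice
    point. *)
Lemma corner_fold_point (R : realType) (C : cube R) f (x y : R) :
  proper_frame f -> 0 <= x < 1 -> 0 <= y < 1 ->
  corners C (fold_point C f x y) -> x = 0 /\ y = 0.
Proof.
move=> [xy xz yz] x01 y01 h.
have L0 : side C != 0 by rewrite gt_eqF ?side_gt0.
have {}h i : unit_point f x y 0 i = 0 \/ unit_point f x y 0 i = 1.
  case: (h i); rewrite cube_coord_place.
    by move/eqP; rewrite mulf_eq0 (negbTE L0) => /eqP; left.
  by rewrite -[RHS]mulr1 => /(mulfI L0); right.
split.
  by case: (h (xaxis f)); rewrite mxE eqxx; case: ifP => _; lra.
by case: (h (yaxis f)); rewrite mxE eqxx eq_sym (negbTE xy); case: ifP => _; lra.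
Qed.

Lemma surface_frame (R : realType) (C : cube R) p : surface C p ->
  exists f (x y : R), [/\ proper_frame f, 0 <= x < 1, 0 <= y < 1 &
                          p = fold_point C f x y].
Proof.
move=> [[z c] [/= p01 pz]].
have [[x y] /= [xy xz yz]] : exists ij : 'I_3 * 'I_3,
    [/\ ij.1 != ij.2, ij.1 != z & ij.2 != z].
  case: z {p01 pz} => [[|[|[|//]]] ?].
  - by exists (inord 1, inord 2); rewrite -!val_eqE /= !inordK.
  - by exists (inord 0, inord 2); rewrite -!val_eqE /= !inordK.
  - by exists (inord 0, inord 1); rewrite -!val_eqE /= !inordK.
have L0 := side_gt0 C; have Ln0 : side C != 0 by rewrite gt_eqF.
pose q i := cube_coord C p i / side C.
have pq i : cube_coord C p i = side C * q i by rewrite mulrC divfK.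
have q01 i : 0 <= q i <= 1.
  by rewrite divr_ge0 ?ler_pdivrMr ?mul1r//; case/andP: (p01 i) => // *; rewrite ltW.
(* A coordinate equal to 1 is measured from the far corner; this keeps the offsets below 1. *)
pose b i := if i == z then c else q i == 1.
pose f := Frame x y z b.
have pf : proper_frame f by [].
pose v i := if b i then 1 - q i else q i.
have v01 i : i != z -> 0 <= v i < 1.
  move=> iz; rewrite /v /b (negbTE iz); have := q01 i.
  case: eqVneq => [->|qi] /andP[q0 q1]; first by rewrite subrr lexx ltr01.
  by rewrite q0 lt_neqAle qi.
exists f, (v x), (v y); split=> //; [exact: v01|exact: v01|].
apply: place_cube_coord => i; rewrite pq; congr (_ * _); rewrite mxE /=.
have /or3P[] := ord3_frame i pf => /eqP -> /=.
- by rewrite eqxx /v; case: (b x) => //; ring.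
- by rewrite eqxx eq_sym (negbTE xy) /v; case: (b y) => //; ring.
- rewrite ![z == _]eq_sym (negbTE xz) (negbTE yz) /b eqxx /q pz.
  by case: (c); rewrite ?divff ?mul0r.
Qed.

(** Here the frame is prescribed, so that, unlike in [surface_frame], an offset can be equal to
    1. *)
Lemma face_frame (R : realType) (C : cube R) f p : proper_frame f ->
  face C (base_face f) p ->
  exists x y : R, [/\ 0 <= x <= 1, 0 <= y <= 1 & p = fold_point C f x y].
Proof.
move=> pf [p01 /= pz]; have [xy xz yz] := pf.
have L0 := side_gt0 C; have Ln0 : side C != 0 by rewrite gt_eqF.
pose q i := cube_coord C p i / side C.
have pq i : cube_coord C p i = side C * q i by rewrite mulrC divfK.
have q01 i : 0 <= q i <= 1.
  by rewrite divr_ge0 ?ler_pdivrMr ?mul1r//; case/andP: (p01 i) => // *; rewrite ltW.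
pose v i := if corner_bit f i then 1 - q i else q i.
have v01 i : 0 <= v i <= 1 by rewrite /v; have := q01 i; case: ifP => _; lra.
exists (v (xaxis f)), (v (yaxis f)); split; [exact: v01|exact: v01|].
apply: place_cube_coord => i; rewrite pq; congr (_ * _); rewrite mxE.
have /or3P[] := ord3_frame i pf => /eqP ->.
- by rewrite eqxx /v; case: (corner_bit f (xaxis f)) => //; ring.
- by rewrite eqxx eq_sym (negbTE xy) /v; case: (corner_bit f (yaxis f)) => //; ring.
- rewrite ![zaxis f == _]eq_sym (negbTE xz) (negbTE yz) /q pz.
  by case: corner_bit; rewrite ?divff ?mul0r.
Qed.

(** * Distances inside a face *)

(** On a segment the lengths of the pieces of a partition telescope. *)
Lemma segment_length (R : realType) (a v : 'rV[R]_3) :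
  (curve_length (fun s => a + s *: v)%R <= (euclid_norm v)%:E)%E.
Proof.
apply: ge_ereal_sup => _ [s [sP /eqP s1] <-]; rewrite lee_fin.
rewrite (eq_big_nat _ _ (F2 := fun n : nat =>
    nth 1 (0 :: s) n.+1 * euclid_norm v - nth 1 (0 :: s) n * euclid_norm v)).
  rewrite telescope_sumr//= -[nth 1 (0 :: s) (size s)]/(nth 1 (0 :: s) (size (0 :: s)).-1).
  by rewrite nth_last /= s1 mul1r mul0r subr0.
move=> n /andP[_ ns]; rewrite opprD addrACA subrr add0r -scalerBl euclid_normZ.
rewrite -mulrBl ger0_norm// subr_ge0 ltW//.
by move/pathP: sP => /(_ 1 n ns).
Qed.

Lemma sqrt_sum_sqr_le (R : realType) (a b : R) :
  Num.sqrt (a ^+ 2 + b ^+ 2) <= `|a| + `|b|.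
Proof.
have ab0 : 0 <= `|a| + `|b| by rewrite addr_ge0.
rewrite -(ger0_norm ab0) -(sqrtr_sqr (`|a| + `|b|)) ler_wsqrtr//.
rewrite -(real_normK (num_real a)) -(real_normK (num_real b)).
by have := normr_ge0 a; have := normr_ge0 b; nra.
Qed.

(** The straight segment inside the face is an admissible path, and its length is at most the sum of
    its extents along the two axes. *)
Lemma fold_point_in_ball (R : realType) (C : cube R) f (x1 y1 x2 y2 r : R) :
  proper_frame f -> 0 <= x1 <= 1 -> 0 <= y1 <= 1 -> 0 <= x2 <= 1 ->
  0 <= y2 <= 1 -> side C * (`|x2 - x1| + `|y2 - y1|) < r ->
  intrinsic_ball C (fold_point C f x1 y1) r (fold_point C f x2 y2).
Proof.
move=> pf x1P y1P x2P y2P hr; split.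
  by exists (base_face f); exact: face_fold_point.
have L0 := side_gt0 C.
pose v := side C *: (unit_vector f (x2 - x1) (y2 - y1) *m axes C).
have cE s : fold_point C f (x1 + s * (x2 - x1)) (y1 + s * (y2 - y1)) =
            fold_point C f x1 y1 + s *: v by exact: fold_pointD.
apply: (@le_lt_trans _ _ (euclid_norm v)%:E); last first.
  rewrite lte_fin; apply: le_lt_trans hr.
  rewrite euclid_normZ gtr0_norm// ler_pM2l// euclid_norm_mul_axes.
  by rewrite euclid_norm_unit_vector// sqrt_sum_sqr_le.
apply: le_trans (segment_length (fold_point C f x1 y1) v).
apply: ereal_inf_lbound; exists (fun s => fold_point C f x1 y1 + s *: v) => //.
split.
- apply: continuous_subspaceT => s.
  by apply: cvgD; [exact: cvg_cst|apply: cvgZl; exact: cvg_id].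
- by rewrite scale0r addr0.
- by rewrite -cE !mul1r ![_ + (_ - _)]addrC !subrK.
- move=> s /andP[s0 s1]; rewrite -cE; exists (base_face f).
  by apply: face_fold_point => //; apply/andP; split; nra.
Qed.

(** * Geodesics obtained by folding straight lines of the plane *)

Lemma affine_lt_near (R : realType) (a b c d s : R) : 0 < d ->
  b < a + s * d -> a + s * d < c ->
  exists2 e : R, 0 < e & forall u, `|u - s| < e -> b < a + u * d < c.
Proof.
move=> d0 lb lc.
have eb : 0 < (a + s * d - b) / d by rewrite divr_gt0// subr_gt0.
have ec : 0 < (c - (a + s * d)) / d by rewrite divr_gt0// subr_gt0.
exists (Num.min ((a + s * d - b) / d) ((c - (a + s * d)) / d)).
  by rewrite lt_min eb ec.
move=> u; rewrite lt_min !ltr_pdivlMr// => /andP[].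
rewrite -[in `|_| * d](gtr0_norm d0) -normrM => /ltr_normlP[].
by rewrite !ltr_norml => h1 h2 /andP[h3 h4]; apply/andP; split; lra.
Qed.

Section LineGeodesic.
Variables (R : realType) (C : cube R) (T px py d1 d2 : R).
Variable (cell_frame : nat -> nat -> frame).
Let X (u : R) := px + u * d1.
Let Y (u : R) := py + u * d2.

(** The plane is measured in units of the side. Since [Num.truncn] rounds down, a point on a grid
    line belongs to the cell to the right of it or above it. *)
Definition folded_line (u : R) : 'rV[R]_3 :=
  let j := Num.truncn (X u) in let k := Num.truncn (Y u) in
  fold_point C (cell_frame j k) (X u - j%:R) (Y u - k%:R).

Hypotheses (px01 : 0 <= px < 1) (py01 : 0 <= py < 1).
Hypotheses (d10 : 0 < d1) (d20 : 0 < d2).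
Hypothesis unit_speed : side C ^+ 2 * (d1 ^+ 2 + d2 ^+ 2) = 1.
Hypothesis proper_cell : forall j k, proper_frame (cell_frame j k).
Hypothesis avoids_lattice : forall s (j k : nat), 0 < s <= T ->
  X s = j%:R -> Y s = k%:R -> False.
(** Rolling right then up differs from rolling up then right, so the frames cannot match across all
    edges of the grid; they match across those that the line crosses. *)
Hypothesis cross_right : forall s (j : nat), 0 < s <= T -> X s = j.+1%:R ->
  cell_frame j.+1 (Num.truncn (Y s)) =
  roll_right (cell_frame j (Num.truncn (Y s))).
Hypothesis cross_up : forall s (k : nat), 0 < s <= T -> Y s = k.+1%:R ->
  cell_frame (Num.truncn (X s)) k.+1 =
  roll_up (cell_frame (Num.truncn (X s)) k).

Let X0 u : 0 <= u -> 0 <= X u.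
Proof. by case/andP: px01 => *; rewrite addr_ge0// mulr_ge0// ltW. Qed.

Let Y0 u : 0 <= u -> 0 <= Y u.
Proof. by case/andP: py01 => *; rewrite addr_ge0// mulr_ge0// ltW. Qed.

Lemma folded_line_cell u (j k : nat) : j%:R <= X u < j.+1%:R ->
  k%:R <= Y u < k.+1%:R ->
  folded_line u = fold_point C (cell_frame j k) (X u - j%:R) (Y u - k%:R).
Proof. by move=> jX kY; rewrite /folded_line (truncn_def jX) (truncn_def kY). Qed.

Lemma developed_direction f : proper_frame f ->
  euclid_norm (side C *: (unit_vector f d1 d2 *m axes C)) = 1.
Proof.
move=> pf; have L0 := side_gt0 C.
rewrite euclid_normZ euclid_norm_mul_axes euclid_norm_unit_vector//.
by rewrite -sqrtr_sqr -sqrtrM ?sqr_ge0// unit_speed sqrtr1.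
Qed.

Lemma developed_line f (j k : nat) u :
  fold_point C f (X u - j%:R) (Y u - k%:R) =
  fold_point C f (px - j%:R) (py - k%:R) +
  u *: (side C *: (unit_vector f d1 d2 *m axes C)).
Proof. by rewrite -fold_pointD /X /Y; congr fold_point; ring. Qed.

Lemma geodesic_in_cell s (j k : nat) (e : R) : 0 < e ->
  (forall u, 0 <= u <= T -> `|u - s| < e ->
     j%:R <= X u < j.+1%:R /\ k%:R <= Y u < k.+1%:R) ->
  exists e : R, 0 < e /\
  exists F G : face_index, F.1 != G.1 /\
  exists a v : 'rV[R]_3, euclid_norm v = 1 /\
  forall u, 0 <= u <= T -> `|u - s| < e ->
    (face C F `|` face C G) (folded_line u) /\
    develop C F G (folded_line u) = a + u *: v.
Proof.
move=> e0 near; exists e; split=> //.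
have pf := proper_cell j k; set f := cell_frame j k in pf *.
(* The line stays in one face here; any adjacent face can serve as the second one. *)
exists (base_face f), (base_face (roll_right f)); split.
  by have [_ xz _] := pf; rewrite eq_sym.
exists (fold_point C f (px - j%:R) (py - k%:R)).
exists (side C *: (unit_vector f d1 d2 *m axes C)).
split; first exact: developed_direction.
move=> u uT us; have [jX kY] := near u uT us.
rewrite (folded_line_cell jX kY) develop_base// -developed_line; split=> //.
by left; apply: face_fold_point => //; move: jX kY; rewrite -!natr1; lra.
Qed.

(** Before the crossing the development is the identity, afterwards it is given by
    [develop_roll_right]; both parts then lie on the same line in the plane of the first face. *)
Lemma geodesic_cross_right s (j k : nat) (e : R) : 0 < e ->
  X s = j.+1%:R -> cell_frame j.+1 k = roll_right (cell_frame j k) ->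
  (forall u, 0 <= u <= T -> `|u - s| < e ->
     j%:R <= X u < j.+2%:R /\ k%:R <= Y u < k.+1%:R) ->
  exists e : R, 0 < e /\
  exists F G : face_index, F.1 != G.1 /\
  exists a v : 'rV[R]_3, euclid_norm v = 1 /\
  forall u, 0 <= u <= T -> `|u - s| < e ->
    (face C F `|` face C G) (folded_line u) /\
    develop C F G (folded_line u) = a + u *: v.
Proof.
move=> e0 Xs fE near; exists e; split=> //.
have pf := proper_cell j k; set f := cell_frame j k in pf fE *.
exists (base_face f), (base_face (roll_right f)); split.
  by have [_ xz _] := pf; rewrite eq_sym.
exists (fold_point C f (px - j%:R) (py - k%:R)).
exists (side C *: (unit_vector f d1 d2 *m axes C)).
split; first exact: developed_direction.
move=> u uT us; have [jX kY] := near u uT us; rewrite -(developed_line _ j k).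
have [Xu|Xu] := ltP (X u) j.+1%:R.
  have jX' : j%:R <= X u < j.+1%:R by rewrite Xu andbT; case/andP: jX.
  rewrite (folded_line_cell jX' kY) develop_base//; split=> //.
  by left; apply: face_fold_point => //; move: jX' kY; rewrite -!natr1; lra.
have jX' : j.+1%:R <= X u < j.+2%:R by rewrite Xu; case/andP: jX.
rewrite (folded_line_cell jX' kY) fE develop_roll_right//; split.
  right; apply: face_fold_point; first exact: proper_roll_right.
    by move: jX'; rewrite -!natr1; lra.
  by move: kY; rewrite -!natr1; lra.
by congr fold_point; rewrite -natr1; ring.
Qed.

Lemma geodesic_cross_up s (j k : nat) (e : R) : 0 < e ->
  Y s = k.+1%:R -> cell_frame j k.+1 = roll_up (cell_frame j k) ->
  (forall u, 0 <= u <= T -> `|u - s| < e ->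
     j%:R <= X u < j.+1%:R /\ k%:R <= Y u < k.+2%:R) ->
  exists e : R, 0 < e /\
  exists F G : face_index, F.1 != G.1 /\
  exists a v : 'rV[R]_3, euclid_norm v = 1 /\
  forall u, 0 <= u <= T -> `|u - s| < e ->
    (face C F `|` face C G) (folded_line u) /\
    develop C F G (folded_line u) = a + u *: v.
Proof.
move=> e0 Ys fE near; exists e; split=> //.
have pf := proper_cell j k; set f := cell_frame j k in pf fE *.
exists (base_face f), (base_face (roll_up f)); split.
  by have [_ _ yz] := pf; rewrite eq_sym.
exists (fold_point C f (px - j%:R) (py - k%:R)).
exists (side C *: (unit_vector f d1 d2 *m axes C)).
split; first exact: developed_direction.
move=> u uT us; have [jX kY] := near u uT us; rewrite -(developed_line _ j k).
have [Yu|Yu] := ltP (Y u) k.+1%:R.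
  have kY' : k%:R <= Y u < k.+1%:R by rewrite Yu andbT; case/andP: kY.
  rewrite (folded_line_cell jX kY') develop_base//; split=> //.
  by left; apply: face_fold_point => //; move: jX kY'; rewrite -!natr1; lra.
have kY' : k.+1%:R <= Y u < k.+2%:R by rewrite Yu; case/andP: kY.
rewrite (folded_line_cell jX kY') fE develop_roll_up//; split.
  right; apply: face_fold_point; first exact: proper_roll_up.
    by move: jX; rewrite -!natr1; lra.
  by move: kY'; rewrite -!natr1; lra.
by congr fold_point; rewrite -natr1; ring.
Qed.

Lemma folded_line_geodesic : geodesic C T folded_line.
Proof.
move=> s /andP[s0 sT].
have /andP[jX Xj] := truncn_itv (X0 s0).
have /andP[kY Yk] := truncn_itv (Y0 s0).
move: jX Xj kY Yk; set j := Num.truncn (X s); set k := Num.truncn (Y s).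
move=> jX Xj kY Yk.
(* The line may start on an edge or at a corner of its cell. At times [u >= 0] both coordinates are
   nonnegative anyway, so the lower bound -1 suffices in [affine_lt_near]. *)
have [s_eq0|s_neq0] := eqVneq s 0.
  have j0 : j = 0%N by rewrite /j /X s_eq0 mul0r addr0; apply: truncn_def.
  have k0 : k = 0%N by rewrite /k /Y s_eq0 mul0r addr0; apply: truncn_def.
  rewrite j0 k0 in jX Xj kY Yk.
  have [e1 e10 h1] := @affine_lt_near _ px (-1) 1 d1 s d10
    (lt_le_trans (ltrN10 R) jX) Xj.
  have [e2 e20 h2] := @affine_lt_near _ py (-1) 1 d2 s d20
    (lt_le_trans (ltrN10 R) kY) Yk.
  apply: (@geodesic_in_cell s 0 0 (Num.min e1 e2)); first by rewrite lt_min e10.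
  move=> u /andP[u0 _]; rewrite lt_min => /andP[/h1/andP[_ hX] /h2/andP[_ hY]].
  by rewrite X0// Y0.
have sT' : 0 < s <= T by rewrite lt_neqAle eq_sym s_neq0 s0.
have [jXE|jXn] := eqVneq (X s) j%:R.
  have [kYE|kYn] := eqVneq (Y s) k%:R.
    by case: (avoids_lattice sT' jXE kYE).
  have kY' : k%:R < Y s by rewrite lt_neqAle eq_sym kYn.
  case: j jX Xj jXE => [|j] jX Xj jXE.
    suff : 0 < X s by rewrite jXE ltxx.
    by rewrite ltr_wpDl ?mulr_gt0//; [case/andP: px01|case/andP: sT'].
  have [|e1 e10 h1] := @affine_lt_near _ px j%:R j.+2%:R d1 s d10 _ Xj.
    by rewrite -/(X s) jXE ltr_nat.
  have [e2 e20 h2] := @affine_lt_near _ py k%:R k.+1%:R d2 s d20 kY' Yk.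
  apply: (@geodesic_cross_right s j k (Num.min e1 e2)) => //.
  - by rewrite lt_min e10.
  - exact: cross_right.
  move=> u _; rewrite lt_min => /andP[/h1/andP[hX1 hX2] /h2/andP[hY1 hY2]].
  by rewrite (ltW hX1) hX2 (ltW hY1).
have jX' : j%:R < X s by rewrite lt_neqAle eq_sym jXn.
have [e1 e10 h1] := @affine_lt_near _ px j%:R j.+1%:R d1 s d10 jX' Xj.
have [kYE|kYn] := eqVneq (Y s) k%:R.
  case: k kY Yk kYE => [|k] kY Yk kYE.
    suff : 0 < Y s by rewrite kYE ltxx.
    by rewrite ltr_wpDl ?mulr_gt0//; [case/andP: py01|case/andP: sT'].
  have [|e2 e20 h2] := @affine_lt_near _ py k%:R k.+2%:R d2 s d20 _ Yk.
    by rewrite -/(Y s) kYE ltr_nat.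
  apply: (@geodesic_cross_up s j k (Num.min e1 e2)) => //.
  - by rewrite lt_min e10.
  - exact: cross_up.
  move=> u _; rewrite lt_min => /andP[/h1/andP[hX1 hX2] /h2/andP[hY1 hY2]].
  by rewrite (ltW hX1) hX2 (ltW hY1).
have kY' : k%:R < Y s by rewrite lt_neqAle eq_sym kYn.
have [e2 e20 h2] := @affine_lt_near _ py k%:R k.+1%:R d2 s d20 kY' Yk.
apply: (@geodesic_in_cell s j k (Num.min e1 e2)); first by rewrite lt_min e10.
move=> u _; rewrite lt_min => /andP[/h1/andP[hX1 hX2] /h2/andP[hY1 hY2]].
by rewrite (ltW hX1) hX2 (ltW hY1).
Qed.

Lemma wave_front_folded_line : 0 < T ->
  wave_front C T (fold_point C (cell_frame 0 0) px py) (folded_line T).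
Proof.
move=> T0; exists folded_line; split=> //.
- exact: folded_line_geodesic.
- have X_0 : X 0 = px by rewrite /X mul0r addr0.
  have Y_0 : Y 0 = py by rewrite /Y mul0r addr0.
  by rewrite (@folded_line_cell 0 0 0) ?X_0 ?Y_0 ?subr0.
- move=> s sT; have s0 : 0 <= s by rewrite ltW; case/andP: sT.
  have jX := truncn_itv (X0 s0); have kY := truncn_itv (Y0 s0).
  rewrite (folded_line_cell jX kY) => /corner_fold_point[]//.
  + by move: jX; rewrite -natr1; lra.
  + by move: kY; rewrite -natr1; lra.
  + by move=> /eqP; rewrite subr_eq0 => /eqP h1 /eqP; rewrite subr_eq0 => /eqP;
      exact: (avoids_lattice sT h1).
Qed.

End LineGeodesic.

(** * Lines of slope slightly above a multiple of four *)

(* The frame in which a line enters column [j] if [row j] is the row at which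
   it enters, for a cube that starts in column 0 and row 0. *)
Fixpoint column_frame (row : nat -> nat) (f : frame) (j : nat) : frame :=
  if j is i.+1 then
    roll_right (iter (row i.+1 - row i) roll_up (column_frame row f i))
  else f.

(* A step up, conjugated by [b] steps to the right; [roll_right] has order 4, so
   [3 * b] steps undo [b] steps. *)
Definition conjugated_up (b : nat) (f : frame) : frame :=
  iter (3 * b) roll_right (roll_up (iter b roll_right f)).

(** The effect of steps up in the columns [col 0], [col 1], and so on, each transported back to
    column 0. *)
Fixpoint conjugated_ups (col : nat -> nat) (f : frame) (n : nat) : frame :=
  if n is i.+1 then conjugated_up (col i) (conjugated_ups col f i) else f.

Lemma conjugated_up_mod a b f :
  (a = b %[mod 4])%N -> conjugated_up a f = conjugated_up b f.
Proof.
move=> ab; rewrite /conjugated_up (iter_right_mod _ ab).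
by apply: iter_right_mod; lia.
Qed.

Lemma right_conjugated_up b f :
  iter b roll_right (conjugated_up b f) = roll_up (iter b roll_right f).
Proof. by rewrite -iterD (@iter_right_mod _ 0)//; lia. Qed.

Lemma conjugated_up4 b f : iter 4 (conjugated_up b) f = f.
Proof.
rewrite /= {1}/conjugated_up !right_conjugated_up.
rewrite -[roll_up (roll_up _)]/(iter 4 roll_up (iter b roll_right f)) roll_up4.
by rewrite -iterD (@iter_right_mod _ 0)//; lia.
Qed.

Lemma conjugated_up_opp b f : conjugated_up (b + 2) (conjugated_up b f) = f.
Proof.
rewrite {1}/conjugated_up (addnC b 2) iterD right_conjugated_up up_right2_up.
by rewrite -!iterD (@iter_right_mod _ 0)//; lia.
Qed.

Lemma proper_column_frame row f j :
  proper_frame f -> proper_frame (column_frame row f j).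
Proof.
by move=> pf; elim: j => //= j IHj; apply/proper_roll_right/proper_iter_up.
Qed.

(** When all steps to the right are moved to the end, a step up in column [j] becomes
    [conjugated_up j]. The [e] initial steps up are made in column 0, where no conjugation
    occurs. *)
Lemma column_frameE (row cnt col : nat -> nat) (e M : nat) f :
  row 0 = 0%N -> cnt 0 = 0%N ->
  (forall j, (0 < j <= M)%N -> (row j = e + cnt j %[mod 4])%N) ->
  (forall j, (j < M)%N -> (row j <= row j.+1)%N) ->
  (forall j, (j < M)%N -> cnt j.+1 = cnt j \/
     cnt j.+1 = (cnt j).+1 /\ col (cnt j) = j) ->
  forall j, (0 < j <= M)%N -> column_frame row f j =
    iter j roll_right (conjugated_ups col (iter e roll_up f) (cnt j)).
Proof.
move=> row0 cnt0 rowE row_le cntS; elim=> // j IHj /= jM.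
have step g : roll_right (roll_up (iter j roll_right g)) =
    iter j.+1 roll_right (conjugated_up j g).
  by rewrite iterS right_conjugated_up.
have := rowE j.+1 jM; have := row_le j jM; have := cntS j jM.
case: (posnP j) => [j0|j_gt0].
  rewrite j0 /= row0 cnt0 subn0 => -[->|[-> col0]] _ rE.
    by rewrite (iter_up_mod _ rE) addn0.
  by rewrite (iter_up_mod _ rE) /= col0 addn1.
have jM' : (0 < j <= M)%N by rewrite j_gt0 ltnW.
rewrite (IHj jM') => -[->|[-> colj]] le_row rE; have rE' := rowE j jM'.
  by rewrite (@iter_up_mod _ 0) //; lia.
by rewrite (@iter_up_mod _ 1) /= ?colj -?step //; lia.
Qed.

(** For even [s] the columns agree modulo 4 and the steps cancel in fours by [conjugated_up4]. For
    odd [s] they alternate between [b] and [b + 2], and consecutive steps cancel by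
    [conjugated_up_opp]. *)
Lemma conjugated_ups_cancel (col : nat -> nat) f (b s n : nat) :
  (forall i, (i < 4 * n)%N -> (col i = b + 2 * s * i %[mod 4])%N) ->
  conjugated_ups col f (4 * n) = f.
Proof.
elim: n => // n IHn colE.
rewrite (_ : 4 * n.+1 = (4 * n).+4)%N /=; last lia.
rewrite IHn; last by move=> i ni; apply: colE; lia.
have [sE|sO] : (s %% 2 = 0 \/ s %% 2 = 1)%N by lia.
  have colb i : (i < 4 * n.+1)%N -> (col i = b %[mod 4])%N.
    move=> /colE ->; rewrite -modnDmr (_ : 2 * s * i %% 4 = 0)%N ?addn0//.
    by rewrite (divn_eq s 2) sE; lia.
  rewrite !(conjugated_up_mod _ (colb _ _)); try lia.
  exact: conjugated_up4.
have colb i : (i < 4 * n.+1)%N -> (col i = b + 2 * i %[mod 4])%N.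
  move=> /colE ->; rewrite (divn_eq s 2) sO.
  by rewrite -modnDmr -[RHS]modnDmr; congr ((_ + _) %% _)%N; lia.
rewrite (@conjugated_up_mod (col (4 * n)) b); last by rewrite colb; lia.
rewrite (@conjugated_up_mod (col (4 * n).+1) (b + 2)); last by rewrite colb; lia.
rewrite (@conjugated_up_mod (col (4 * n).+2) b); last by rewrite colb; lia.
rewrite (@conjugated_up_mod (col (4 * n).+3) (b + 2)); last by rewrite colb; lia.
by rewrite !conjugated_up_opp.
Qed.

Section UnfoldedLine.
Variables (R : realType) (C : cube R) (T px py kappa : R) (f : frame).
Hypotheses (px01 : 0 <= px < 1) (py01 : 0 <= py < 1).
Hypotheses (kappa0 : 0 < kappa) (T0 : 0 < T) (pf : proper_frame f).
(** The horizontal extent, in units of the side, of a segment of length [T] and slope [kappa]. *)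
Let d := T / (side C * Num.sqrt (1 + kappa ^+ 2)).
Let row (j : nat) := Num.truncn (py + (j%:R - px) * kappa).
Hypothesis avoids : forall j k : nat, (0 < j)%N -> j%:R <= px + d ->
  py + (j%:R - px) * kappa != k%:R.

(** The frame of cell [(j, k)] is the one in which the line enters column [j], rolled up [k - row j]
    times. *)
Lemma wave_front_line (M K : nat) : M%:R <= px + d < M.+1%:R ->
  K%:R <= py + kappa * d < K.+1%:R ->
  wave_front C T (fold_point C f px py)
    (fold_point C (iter (K - row M) roll_up (column_frame row f M))
       (px + d - M%:R) (py + kappa * d - K%:R)).
Proof.
move=> MX KY; have L0 := side_gt0 C.
have k10 : 0 < 1 + kappa ^+ 2 by rewrite ltr_pwDl// sqr_ge0.
have dT : 0 < d / T by rewrite divr_gt0// divr_gt0// mulr_gt0// sqrtr_gt0.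
have TdT : T * (d / T) = d by rewrite mulrC divfK// gt_eqF.
have kTdT : T * (kappa * (d / T)) = kappa * d by rewrite mulrCA TdT.
have -> : fold_point C f px py = fold_point C (iter (0 - row 0) roll_up
    (column_frame row f 0)) px py by [].
have -> : fold_point C (iter (K - row M) roll_up (column_frame row f M))
       (px + d - M%:R) (py + kappa * d - K%:R) =
    folded_line C px py (d / T) (kappa * (d / T))
      (fun j k => iter (k - row j) roll_up (column_frame row f j)) T.
  by rewrite (@folded_line_cell _ _ _ _ _ _ _ _ M K) ?kTdT ?TdT.
have below s (j : nat) : 0 < s <= T -> (0 < j)%N ->
    px + s * (d / T) = j%:R -> forall k : nat,
    py + s * (kappa * (d / T)) != k%:R.
  move=> /andP[s0 sT] j0 Xs k.
  have <- : py + (j%:R - px) * kappa = py + s * (kappa * (d / T)).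
    by rewrite -Xs; ring.
  by apply: avoids; rewrite // -Xs -[X in _ <= _ + X]TdT lerD2l ler_pM2r.
have pos s (j : nat) : 0 < s <= T -> px + s * (d / T) = j%:R -> (0 < j)%N.
  move=> /andP[s0 sT] Xs; rewrite -(ltr_nat R) -Xs.
  by case/andP: px01 => px0 _; exact: ltr_wpDl px0 (mulr_gt0 s0 dT).
apply: wave_front_folded_line => //.
- by rewrite mulr_gt0.
- have -> : d / T = (side C * Num.sqrt (1 + kappa ^+ 2))^-1.
    by rewrite /d mulrAC divff ?mul1r// gt_eqF.
  rewrite exprMn exprVn exprMn sqr_sqrtr ?ltW//.
  by field; rewrite !gt_eqF.
- by move=> j k; apply/proper_iter_up/proper_column_frame.
- move=> s j k sT Xs; have := below s j sT (pos s j sT Xs) Xs k.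
  by move/eqP.
- move=> s j sT Xs /=.
  have -> : Num.truncn (py + s * (kappa * (d / T))) = row j.+1.
    by rewrite /row -Xs; congr Num.truncn; ring.
  by rewrite subnn.
- move=> s k sT Ys /=; set X := px + s * (d / T) in Ys *.
  have X0 : 0 <= X.
    case/andP: sT px01 => s0 _ /andP[px0 _].
    exact: addr_ge0 px0 (ltW (mulr_gt0 s0 dT)).
  have /andP[jX Xj] := truncn_itv X0.
  (* It remains to see that the line enters this column strictly below height [k + 1]; equality
     would put a lattice point on the line. *)
  rewrite subSn// truncn_le_nat -Ys.
  have -> : py + s * (kappa * (d / T)) = py + (X - px) * kappa.
    by rewrite /X; ring.
  rewrite ltrD2l ltr_pM2r// ltrD2r lt_neqAle jX andbT.
  apply/negP => /eqP jXE; have := below s _ sT (pos s _ sT (esym jXE)) (esym jXE) k.+1.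
  by rewrite Ys eqxx.
Qed.

End UnfoldedLine.

(* A line of slope [N + 1 / S] with [4 %| N] takes, up to full turns, no step up
   in most columns, and one step up in the columns [col i]. *)
Lemma wave_front_steep_line (R : realType) (C : cube R) (T px py c S : R)
    (z : int) (N e m M K : nat) (col : nat -> nat) (f : frame) :
  let kappa := (4 * N)%:R + S^-1 in
  let d := T / (side C * Num.sqrt (1 + kappa ^+ 2)) in
  0 <= px < 1 -> 0 <= py < 1 -> 0 < T -> proper_frame f -> 1 <= S ->
  0 <= c < 1 -> py - (4 * N)%:R * px = e%:R + 4 * z%:~R + c ->
  (forall i, (i < m)%N ->
    (col i)%:R < px + (1 - c + i%:R) * S < (col i).+1%:R) ->
  px + (1 - c + m.-1%:R) * S <= M%:R -> px + d < px + (1 - c + m%:R) * S ->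
  M%:R <= px + d < M.+1%:R -> K%:R <= py + kappa * d < K.+1%:R ->
  (K = e + m %[mod 4])%N -> (0 < m)%N ->
  wave_front C T (fold_point C f px py)
    (fold_point C (iter M roll_right
         (conjugated_ups col (iter e roll_up f) m))
       (px + d - M%:R) (py + kappa * d - K%:R)).
Proof.
move=> kappa d px01 py01 T0 pf S1 c01 cE colP xm dm MX KY Kmod m0.
have S0 : 0 < S by lra.
have Si0 : 0 < S^-1 by rewrite invr_gt0.
have SSi : S * S^-1 = 1 by rewrite divff// gt_eqF.
have kappa0 : 0 < kappa by rewrite ltr_wpDl// ler0n.
(* Up to [e] and a multiple of 4, [h j] is the height at which the line enters column [j]; so
   [cnt j] counts the additional steps made before. *)
pose h (j : nat) : R := c + (j%:R - px) * S^-1.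
pose cnt j := Num.truncn (h j).
pose row j := Num.truncn (py + (j%:R - px) * kappa).
have rowR j : py + (j%:R - px) * kappa = (4 * N * j + e)%:R + 4 * z%:~R + h j.
  rewrite /kappa /h.
  have -> : py + (j%:R - px) * ((4 * N)%:R + S^-1) =
    (py - (4 * N)%:R * px) + (4 * N)%:R * j%:R + (j%:R - px) * S^-1 by ring.
  by rewrite cE [(4 * N * j + e)%:R]natrD natrM; ring.
(* Additional step [i] is made at abscissa [px + (1 - c + i) * S]. *)
have h_ge (i j : nat) : (i.+1%:R <= h j) = (px + (1 - c + i%:R) * S <= j%:R).
  rewrite /h -lerBlDl ler_pdivlMr// -lerBrDl -natr1.
  by congr (_ <= _); ring.
have h_lt (i j : nat) : (h j < i.+1%:R) = (j%:R < px + (1 - c + i%:R) * S).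
  by rewrite !ltNge h_ge.
have h0 j : (0 < j)%N -> 0 <= h j.
  move=> j0; have : (1 : R) <= j%:R by rewrite ler1n.
  by move=> j1; rewrite addr_ge0 ?mulr_ge0//; lra.
have h_m j : j%:R <= px + d -> h j < m.+1%:R.
  by move=> jd; rewrite h_lt; exact: le_lt_trans dm.
have cnt_m j : j%:R <= px + d -> (cnt j <= m)%N.
  by move=> /h_m; rewrite truncn_le_nat.
have mE : m = m.-1.+1 by rewrite prednK.
have cntM : cnt M = m.
  apply/eqP; rewrite eqn_leq cnt_m ?(andP MX).1//=.
  by rewrite mE truncn_gt_nat h_ge.
(* As [z] may be negative, this is an equation between integers. *)
have rowZ j : (0 < j)%N -> (row j)%:Z = (4 * N * j + e)%:Z + 4 * z + (cnt j)%:Z.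
  move=> j0; have y0 : 0 <= py + (j%:R - px) * kappa.
    have : (1 : R) <= j%:R by rewrite ler1n.
    by move=> j1; rewrite addr_ge0 ?mulr_ge0//; lra.
  have := truncn_itv y0; rewrite -/(row j) rowR => /andP[r1 r2].
  have /andP[c1 c2] := truncn_itv (h0 j j0); rewrite -/(cnt j) in c1 c2.
  have u1 : ((row j)%:Z < (4 * N * j + e)%:Z + 4 * z + (cnt j)%:Z + 1).
    rewrite -(ltr_int R) !rmorphD/= rmorphM/= -!pmulrn.
    by move: c2 r1; rewrite -natr1; lra.
  have u2 : ((4 * N * j + e)%:Z + 4 * z + (cnt j)%:Z < (row j)%:Z + 1).
    rewrite -(ltr_int R) !rmorphD/= rmorphM/= -!pmulrn.
    by move: c1 r2; rewrite -natr1; lra.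
  by apply/eqP; rewrite eq_le -!ltzD1 u1.
have rowE j : (0 < j)%N -> (row j = e + cnt j %[mod 4])%N.
  move=> /rowZ; rewrite -mulnA; move: (N * j)%N (row j) (cnt j) => Nj rj cj; clear; lia.
(* At a lattice point [h j] would be a positive integer, so an additional step would be made exactly
   at abscissa [j], against the strict bounds in [colP]. *)
have avoids (j k : nat) : (0 < j)%N -> j%:R <= px + d ->
    py + (j%:R - px) * kappa != k%:R.
  move=> j0 jd; apply/eqP; rewrite rowR => hk.
  have hjE : h j = (k%:Z - (4 * N * j + e)%:Z - 4 * z)%:~R.
    by rewrite !rmorphB/= rmorphM/= -!pmulrn; lra.
  have : 0 < h j.
    have j1 : (1 : R) <= j%:R by rewrite ler1n.
    by rewrite ltr_wpDl ?mulr_gt0//; lra.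
  rewrite hjE ltr0z; move: hjE; case: (_ - 4 * z) => // -[//|i] hjE _.
  have im : (i < m)%N by have := h_m j jd; rewrite hjE -pmulrn ltr_nat.
  have xj : px + (1 - c + i%:R) * S = j%:R.
    have : (j%:R - px) * S^-1 * S = (1 + i%:R - c) * S.
      by congr (_ * _); move: hjE; rewrite /h -pmulrn -natr1; lra.
    by rewrite mulfVK ?gt_eqF//; lra.
  by have := colP _ im; rewrite xj !ltr_nat ltnS ltnNge => /andP[/negP].
have M0 : (0 < M)%N.
  rewrite -(ltr_nat R); apply: lt_le_trans xm.
  have : 0 < (1 - c + m.-1%:R) * S.
    by rewrite mulr_gt0// ltr_wpDr ?ler0n//; lra.
  by lra.
have row0 : row 0 = 0%N.
  apply/eqP; rewrite -leqn0 truncn_le_nat.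
  have : 0 <= px * kappa by rewrite mulr_ge0//; lra.
  by lra.
have cnt0 : cnt 0 = 0%N.
  apply/eqP; rewrite -leqn0 truncn_le_nat.
  have : 0 <= px * S^-1 by rewrite mulr_ge0//; lra.
  by rewrite /h; lra.
have := @wave_front_line R C T px py kappa f px01 py01 kappa0 T0 pf avoids M K MX KY.
rewrite -/d -/row.
rewrite (@column_frameE row cnt col e M f)//; last 4 first.
- by move=> j /andP[j0 _]; exact: rowE.
- move=> j _; apply: le_truncn; rewrite lerD2l ler_pM2r// lerD2r.
  by rewrite ler_nat.
- move=> j jM.
  have jd : j.+1%:R <= px + d.
    by apply: le_trans (andP MX).1; rewrite ler_nat.
  (* As [S >= 1], each column contains at most one additional step. *)
  have hS : h j <= h j.+1 <= h j + 1.
    rewrite /h -natr1; have : S^-1 <= 1 by rewrite invf_le1.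
    by lra.
  have le1 : (cnt j <= cnt j.+1)%N by apply: le_truncn; case/andP: hS.
  have le2 : (cnt j.+1 <= (cnt j).+1)%N.
    rewrite truncn_le_nat -natr1; have := truncnS_gt (h j); rewrite -/(cnt j).
    by lra.
  have [<-|ne] := eqVneq (cnt j) (cnt j.+1); first by left.
  have cntS : cnt j.+1 = (cnt j).+1.
    by apply/eqP; rewrite eqn_leq le2 ltn_neqAle ne.
  right; split=> //.
  have cm : (cnt j < m)%N by rewrite -cntS; exact: cnt_m.
  have /andP[col1 col2] := colP _ cm.
  have : (cnt j).+1%:R <= h j.+1.
    by rewrite -truncn_gt_nat -/(cnt j.+1) cntS.
  rewrite h_ge => x1.
  have := truncnS_gt (h j); rewrite -/(cnt j) h_lt => x2.
  have := lt_le_trans col1 x1; have := lt_trans x2 col2.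
  by rewrite !ltr_nat; move: (col _) => k; clear; lia.
- by rewrite M0 leqnn.
(* The rolls in the last column cancel, since [row M] and [K] agree modulo 4. *)
rewrite cntM (@iter_up_mod (K - row M) 0)//.
have := rowE M M0; rewrite cntM => rM.
have : (row M <= K)%N.
  rewrite truncn_le_nat; apply: le_lt_trans (andP KY).2.
  rewrite [kappa * d]mulrC lerD2l ler_pM2r//.
  by rewrite lerBlDl (andP MX).1.
by move: Kmod rM; clear; lia.
Qed.

(** * The choice of the slope *)

(* Steps of length at most 2 do not jump over an interval of length 2. *)
Lemma progression_hits (R : realType) (x delta : R) (k : nat) :
  0 <= x -> 0 < delta <= 2 ->
  exists2 j : nat, j%:R * delta <= 4 + delta &
    let b := Num.truncn (x + j%:R * delta) in
    (b = k %[mod 4])%N \/ (b + 1 = k %[mod 4])%N.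
Proof.
move=> x0 /andP[d0 d2].
(* The target is the interval from [g] to [g + 2], where [g] is congruent to [k - 1]; the first term
   that reaches [g] lies in it. *)
pose n0 := (Num.truncn x).+1; pose g := (n0 + (k + 3 + 3 * n0) %% 4)%N.
have gk : (g + 1 = k %[mod 4])%N by rewrite /g; move: (n0); clear; lia.
have xn0 : x < n0%:R by exact: truncnS_gt.
have n0x : n0%:R <= x + 1 by rewrite -natr1 lerD2r truncn_le.
have xg : x < g%:R by rewrite (lt_le_trans xn0)// ler_nat leq_addr.
have gx : g%:R <= x + 4.
  have : ((k + 3 + 3 * n0) %% 4 <= 3)%N by clear; lia.
  by rewrite -(ler_nat R) => ?; rewrite natrD; lra.
have ex : exists j : nat, g%:R <= x + j%:R * delta.
  exists (Num.truncn ((g%:R - x) / delta)).+1.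
  have := truncnS_gt ((g%:R - x) / delta).
  by rewrite ltr_pdivrMr// => ?; lra.
case: (ex_minnP ex) => -[|j] jg jmin; first by move: jg; rewrite mul0r; lra.
have jlt : x + j%:R * delta < g%:R.
  by rewrite ltNge; apply/negP => /jmin; rewrite ltnn.
have jSE : j.+1%:R * delta = j%:R * delta + delta by rewrite -natr1; ring.
exists j.+1; first by rewrite jSE; lra.
move=> b; have x1 : 0 <= x + j.+1%:R * delta by rewrite addr_ge0// mulr_ge0// ltW.
have gb : (g <= b)%N by rewrite /b truncn_ge_nat.
have bg : (b <= g.+1)%N by rewrite /b truncn_le_nat jSE -[g.+2%:R]natr1 -[g.+1%:R]natr1; lra.
by move: gk gb bg; move: (g) (b); clear => g b; lia.
Qed.

(* The line of slope [N + 1 / S] takes its i-th additional step up in column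
   [col i]. The increments of [col] are the even number [2 * s], possibly with
   one more column before the last of these steps. *)
Lemma additional_steps (R : realType) (px beta S1 : R) (w k : nat) :
  0 <= px < 1 -> 0 < beta <= 1 -> 0 <= S1 -> (0 < w)%N ->
  exists (S : R) (col : nat -> nat) (b s : nat),
  [/\ S1 <= S <= S1 + (5 + 4 / beta),
      forall i, (i < (4 * w).+1)%N ->
        (col i)%:R < px + (beta + i%:R) * S < (col i).+1%:R,
      forall i, (i < 4 * w)%N -> (col i = b + 2 * s * i %[mod 4])%N &
      (col (4 * w) = k %[mod 4])%N].
Proof.
move=> px01 /andP[b0 b1] S10 w0.
pose s0 := (Num.truncn (S1 / 2)).+1.
have s0E : S1 < 2 * s0%:R <= S1 + 2.
  have : 0 <= S1 / 2 by lra.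
  by move=> /truncn_itv; rewrite /s0 -[(Num.truncn _).+1%:R]natr1; lra.
(* Raising [s0] by one moves the first additional step by [2 * beta]. *)
have [||j jle] := @progression_hits R (px + beta * (2 * s0%:R)) (2 * beta) k.
- by rewrite addr_ge0 ?mulr_ge0//; lra.
- by lra.
set b := Num.truncn _ => bk.
pose s := (s0 + j)%N.
have bE : px + beta * (2 * s0%:R) + j%:R * (2 * beta) = px + beta * (2 * s%:R).
  by rewrite /s natrD; ring.
have x0 : 0 <= px + beta * (2 * s%:R) by rewrite addr_ge0 ?mulr_ge0//; lra.
pose phi := px + beta * (2 * s%:R) - b%:R.
have phi01 : 0 <= phi < 1.
  by have := truncn_itv x0; rewrite /phi /b bE -[(Num.truncn _).+1%:R]natr1; lra.
have sle : 2 * s%:R <= S1 + 4 + 4 / beta.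
  have : j%:R * 2 <= 4 / beta + 2.
    by rewrite -(ler_pM2r b0) mulrDl divfK ?gt_eqF//; lra.
  by rewrite /s natrD; lra.
(* From index [n] on the columns are shifted by one: [n = 4 * w] shifts just the last step,
   [n = 4 * w + 1] shifts none. *)
have [n [n1 nw colk]] : exists n : nat, [/\ (0 < n)%N, (4 * w <= n)%N &
    (b + (n <= 4 * w) = k %[mod 4])%N].
  case: bk => bk.
    by exists (4 * w).+1; rewrite leqnSn ltnn addn0.
  by exists (4 * w)%N; rewrite muln_gt0 w0 leqnn.
have n2 : (4 : R) <= n%:R by rewrite ler_nat (leq_trans _ nw)// leq_pmulr.
(* With this [eta] the fractional part [phi + (beta + i) * eta] would reach 1 at [i = n - 1/2],
   hence strictly between the indices [n - 1] and [n]. *)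
pose eta := (1 - phi) / (n%:R - 2^-1 + beta).
have den0 : 0 < n%:R - 2^-1 + beta by lra.
have eta0 : 0 < eta by rewrite divr_gt0//; lra.
have etaE : eta * (n%:R - 2^-1 + beta) = 1 - phi by rewrite divfK// gt_eqF.
have eta1 : eta < 2^-1 by rewrite ltr_pdivrMr//; lra.
pose col i := (b + 2 * s * i + (n <= i))%N.
exists (2 * s%:R + eta), col, b, s; split.
- by apply/andP; split; rewrite /s ?natrD; move: sle; rewrite /s natrD; [have : 0 <= (j%:R : R) by []|]; lra.
- move=> i iw.
  have -> : px + (beta + i%:R) * (2 * s%:R + eta) =
      (b + 2 * s * i)%:R + (phi + (beta + i%:R) * eta).
    by rewrite /phi natrD !natrM; ring.
  have bi0 : 0 < (beta + i%:R) * eta by rewrite mulr_gt0// ltr_wpDr.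
  rewrite /col; case: leqP => ni; rewrite ?addn1 ?addn0 -?[_.+2%:R]natr1 -[(b + _).+1%:R]natr1.
    have -> : i = n by move: ni iw nw; clear; lia.
    by lra.
  have : (beta + i%:R) * eta <= (beta + n%:R - 1) * eta.
    rewrite ler_pM2r// -addrA lerD2l lerBrDr natr1 ler_nat//.
  by lra.
- by move=> i iw; rewrite /col leqNgt (leq_trans iw nw) addn0.
- rewrite /col -colk; by clear; lia.
Qed.

(** * Reaching a prescribed end point modulo 4 *)

(** The points [(x0 - theta * N, y0 + theta)] run along direction [(-N, 1)]. The first coordinate
    equals [a] modulo 4 for values of [theta] spaced by [4 / N], and one of these brings the second
    within [4 / N] of [b]. Rounding [theta] to a multiple of [4 / (1 + N ^+ 2)] adds at most [4 / N]
    to each error. *)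
Lemma torus_step (R : realType) (N x0 y0 a b : R) : 1 <= N ->
  exists (w : nat) (A B : int),
  [/\ (0 < w)%N, w%:R <= 4 * (1 + N ^+ 2),
      `|x0 - 4 * w%:R * N / (1 + N ^+ 2) - a - 4 * A%:~R| <= 4 / N &
      `|y0 + 4 * w%:R / (1 + N ^+ 2) - b - 4 * B%:~R| <= 8 / N].
Proof.
move=> N1; have N0 : 0 < N by lra.
have q0 : 0 < 1 + N ^+ 2 by rewrite ltr_pwDl// sqr_ge0.
pose A0 := Num.floor ((x0 - a) / 4); pose xi := x0 - a - 4 * A0%:~R.
have xi4 : 0 <= xi < 4.
  by have := floor_itv ((x0 - a) / 4); rewrite rmorphD/= -/A0 /xi; lra.
pose v := y0 - b + xi / N.
pose B := - Num.floor (- v / 4).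
have Bv : 0 <= 4 * B%:~R - v < 4.
  by have := floor_itv (- v / 4); rewrite rmorphD/= /B rmorphN/=; lra.
pose j := - Num.floor (- (N * (4 * B%:~R - v) / 4)).
have jv : 0 <= j%:~R - N * (4 * B%:~R - v) / 4 < 1.
  have := floor_itv (- (N * (4 * B%:~R - v) / 4)).
  by rewrite rmorphD/= /j rmorphN/=; lra.
pose theta := (4 * j%:~R + xi) / N.
have thetaN : theta * N = 4 * j%:~R + xi by rewrite divfK// gt_eqF.
have theta0 : 0 <= theta.
  have : 0 <= N * (4 * B%:~R - v) by rewrite mulr_ge0//; lra.
  by move=> ?; rewrite divr_ge0//; lra.
have thetale : theta < 12.
  have : N * (4 * B%:~R - v) < N * 4 by rewrite ltr_pM2l//; lra.
  by move=> ?; rewrite ltr_pdivrMr//; lra.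
have thetav : 0 <= y0 + theta - b - 4 * B%:~R < 4 / N.
  have -> : y0 + theta - b - 4 * B%:~R =
      4 / N * (j%:~R - N * (4 * B%:~R - v) / 4).
    by rewrite /theta /v; field; rewrite gt_eqF.
  have N40 : 0 < 4 / N by rewrite divr_gt0.
  by rewrite mulr_ge0 ?(ltW N40)//= ?gtr_pMr//; case/andP: jv.
pose w := (Num.truncn (theta * (1 + N ^+ 2) / 4)).+1.
have wE : 0 < w%:R - theta * (1 + N ^+ 2) / 4 <= 1.
  have : 0 <= theta * (1 + N ^+ 2) / 4 by rewrite divr_ge0// mulr_ge0// ltW.
  by move=> /truncn_itv; rewrite /w -natr1; lra.
have wtheta : 0 <= 4 * w%:R / (1 + N ^+ 2) - theta <= 4 / (1 + N ^+ 2).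
  have -> : 4 * w%:R / (1 + N ^+ 2) - theta =
     4 / (1 + N ^+ 2) * (w%:R - theta * (1 + N ^+ 2) / 4).
    by field; rewrite gt_eqF.
  have q40 : 0 < 4 / (1 + N ^+ 2) by rewrite divr_gt0.
  by rewrite mulr_ge0 ?(ltW q40)//= ?ger_pMr//; lra.
have Nq : N * (4 / (1 + N ^+ 2)) <= 4 / N.
  rewrite mulrA ler_pdivrMr// mulrAC ler_pdivlMr//; nra.
have q4N : 4 / (1 + N ^+ 2) <= 4 / N.
  by rewrite ler_pM2l// lef_pV2 ?posrE//; nra.
exists w, (A0 - j), B; split=> //.
- have : theta * (1 + N ^+ 2) <= 12 * (1 + N ^+ 2) by rewrite ler_pM2r// ltW.
  by have N20 := sqr_ge0 N; lra.
- have -> : x0 - 4 * w%:R * N / (1 + N ^+ 2) - a - 4 * (A0 - j)%:~R =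
     - (N * (4 * w%:R / (1 + N ^+ 2) - theta)).
    have -> : x0 = a + 4 * A0%:~R + xi by rewrite /xi; ring.
    have -> : xi = theta * N - 4 * j%:~R by rewrite thetaN; ring.
    by rewrite rmorphB/=; field; rewrite gt_eqF.
  rewrite normrN ger0_norm; last by rewrite mulr_ge0//; lra.
  by apply: le_trans Nq; rewrite ler_pM2l//; lra.
- by rewrite ger0_norm; lra.
Qed.

(* [d] and [kappa * d] are the components of the vector of length [t] and slope
   [kappa = N + 1 / S]; in the basis [(1, N)], [(0, 1)] its components are [d]
   and [d / S]. *)
Lemma steep_vector_estimate (R : realType) (N t Y S rho : R) :
  let l := Num.sqrt (1 + N ^+ 2) in
  let d := t / Num.sqrt (1 + (N + S^-1) ^+ 2) in
  let eps := Y ^+ 2 * (l * rho + 1) / t in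
  1 <= N -> 0 < t -> 0 < Y -> 1 <= rho ->
  t / (l * Y) <= S <= t / (l * Y) + rho ->
  [/\ Y - eps <= d / S <= Y,
      `|d - (l * t - N * Y) / (1 + N ^+ 2)| <= eps &
      `|(N + S^-1) * d - (N * l * t + Y) / (1 + N ^+ 2)| <= eps].
Proof.
move=> l d eps N1 t0 Y0 rho1 /andP[S1 S2].
have q0 : 0 < 1 + N ^+ 2 by nra.
have l0 : 0 < l by rewrite sqrtr_gt0.
have l2 : l ^+ 2 = 1 + N ^+ 2 by rewrite sqr_sqrtr// ltW.
have lN : N <= l by rewrite -(ler_pXn2r (n := 2)) ?nnegrE ?l2 ?(ltW l0)//; lra.
have S0 : 0 < S by apply: lt_le_trans S1; rewrite divr_gt0// mulr_gt0.
have SSi : S * S^-1 = 1 by rewrite divff// gt_eqF.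
pose k := Num.sqrt (1 + (N + S^-1) ^+ 2).
have k0 : 0 < k by rewrite sqrtr_gt0 ltr_pwDl// sqr_ge0.
have k2 : k ^+ 2 = 1 + (N + S^-1) ^+ 2 by rewrite sqr_sqrtr// addr_ge0// sqr_ge0.
have dk : d * k = t by rewrite divfK// gt_eqF.
have d0 : 0 < d by rewrite divr_gt0.
pose y := d / S.
have y0 : 0 < y by rewrite divr_gt0.
have ySk : y * (S * k) = t by rewrite /y mulrA divfK ?gt_eqF.
(* Because [N <= l], this lies between the squares of [l * S] and [l * S + 1]. *)
have Sk2 : (S * k) ^+ 2 = l ^+ 2 * S ^+ 2 + 2 * N * S + 1.
  rewrite exprMn k2 l2.
  have -> : S ^+ 2 * (1 + (N + S^-1) ^+ 2) = S ^+ 2 * (1 + N ^+ 2) + 2 * N * S * (S * S^-1) + (S * S^-1) ^+ 2 by ring.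
  by rewrite SSi; ring.
have Sk0 : 0 < S * k by rewrite mulr_gt0.
have Sk_ge : l * S <= S * k.
  rewrite -(ler_pXn2r (n := 2)) ?nnegrE ?(ltW Sk0) ?mulr_ge0 ?(ltW l0) ?(ltW S0)//.
  by rewrite Sk2 exprMn; nra.
have Sk_le : S * k <= l * S + 1.
  rewrite -(ler_pXn2r (n := 2)) ?nnegrE ?(ltW Sk0) ?addr_ge0 ?mulr_ge0 ?(ltW l0) ?(ltW S0)//.
  by rewrite Sk2; nra.
have lS1 : t <= l * S * Y.
  by move: S1; rewrite ler_pdivrMr ?mulr_gt0//; lra.
have lS2 : l * S * Y <= t + l * rho * Y.
  have : l * Y * S <= l * Y * (t / (l * Y) + rho) by rewrite ler_pM2l ?mulr_gt0.
  by rewrite mulrDr mulrCA divff ?mulr1 ?gt_eqF ?mulr_gt0//; lra.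
have yY : y <= Y.
  rewrite -(ler_pM2r Sk0) ySk; apply: le_trans lS1 _.
  by rewrite mulrC ler_pM2l.
have eps0 : 0 <= eps.
  by rewrite divr_ge0 ?(ltW t0)// mulr_ge0 ?sqr_ge0// addr_ge0// mulr_ge0//; lra.
have epst : eps * t = Y ^+ 2 * (l * rho + 1) by rewrite divfK// gt_eqF.
have yge : Y - eps <= y.
  (* y (S k) = t and Y (S k) <= t + Y (l rho + 1) *)
  have h1 : Y * (S * k) <= t + Y * (l * rho + 1).
    have : Y * (S * k) <= Y * (l * S + 1) by rewrite ler_pM2l.
    by lra.
  have h2 : t <= Y * (S * k) by rewrite -ySk ler_pM2r.
  have h3 : (Y - y) * t <= eps * t.
    have : (Y - y) * t <= (Y - y) * (Y * (S * k)) by rewrite ler_wpM2l// subr_ge0.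
    have : Y * (Y * (S * k)) <= Y * (t + Y * (l * rho + 1)) by rewrite ler_pM2l.
    have : y * (Y * (S * k)) = Y * t by rewrite mulrCA ySk.
    by rewrite epst expr2; lra.
  by move: h3; rewrite ler_pM2r//; lra.
have dS : d = y * S by rewrite /y divfK// gt_eqF.
have kd : (N + S^-1) * d = N * d + y by rewrite /y; ring.
(* [q] and [y] are the inner products of the vector with the orthogonal vectors [(1, N)] and
   [(-N, 1)] of norm [l]. *)
pose q := (1 + N ^+ 2) * d + N * y.
have qpos : 0 < q by rewrite addr_gt0// mulr_gt0//; lra.
have q2 : q ^+ 2 = (l * t) ^+ 2 - y ^+ 2.
  have tE : t ^+ 2 = d ^+ 2 + (N * d + y) ^+ 2.
    by rewrite -dk exprMn k2 -kd; ring.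
  by rewrite exprMn l2 tE /q; ring.
have lt0 : 0 < l * t by rewrite mulr_gt0.
have l1 : 1 <= l by lra.
have q_le : q <= l * t.
  rewrite -(ler_pXn2r (n := 2)) ?nnegrE ?(ltW lt0) ?(ltW qpos)// q2.
  by have := sqr_ge0 y; lra.
have q_ge : l * t - q <= eps.
  have h1 : (l * t - q) * (l * t) <= y ^+ 2.
    have : (l * t - q) * (l * t + q) = (l * t) ^+ 2 - q ^+ 2 by ring.
    rewrite q2.
    have : 0 <= (l * t - q) * q by rewrite mulr_ge0 ?subr_ge0// ltW.
    by lra.
  have h2 : (l * t - q) * t <= (l * t - q) * (l * t).
    by rewrite ler_wpM2l ?subr_ge0// ler_peMl// ltW.
  have h3 : y ^+ 2 <= Y ^+ 2 by rewrite ler_pXn2r ?nnegrE ?(ltW y0) ?(ltW Y0).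
  have h4 : Y ^+ 2 * 1 <= Y ^+ 2 * (l * rho + 1).
    by rewrite ler_wpM2l ?sqr_ge0// lerDr mulr_ge0//; lra.
  by rewrite -(ler_pM2r t0) epst; lra.
have Neps : N * eps <= N ^+ 2 * eps by rewrite ler_wpM2r// ler_eXnr.
have Nq0 : 0 <= N * (l * t - q) by rewrite mulr_ge0 ?subr_ge0//; lra.
have Nq1 : N * (l * t - q) <= N * eps by rewrite ler_pM2l//; lra.
have Ny0 : 0 <= N * (Y - y) by rewrite mulr_ge0 ?subr_ge0//; lra.
have Ny1 : N * (Y - y) <= N * eps by rewrite ler_pM2l//; lra.
split; first by rewrite yge yY.
- have -> : d - (l * t - N * Y) / (1 + N ^+ 2) =
     (q - l * t + N * (Y - y)) / (1 + N ^+ 2).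
    by rewrite /q; field; rewrite gt_eqF.
  rewrite ler_norml ler_pdivlMr// ler_pdivrMr//.
  by apply/andP; split; lra.
- have -> : (N + S^-1) * d - (N * l * t + Y) / (1 + N ^+ 2) =
     (N * (q - l * t) + (y - Y)) / (1 + N ^+ 2).
    by rewrite kd /q; field; rewrite gt_eqF.
  rewrite ler_norml ler_pdivlMr// ler_pdivrMr//.
  by apply/andP; split; lra.
Qed.

(** Targets are moved away from the edges, so that an error below [mu] cannot change the integer
    part in [truncn_near_mod4]. *)
Lemma clamp_unit (R : realType) (mu q : R) : 0 < mu <= 4^-1 -> 0 <= q <= 1 ->
  exists2 q' : R, mu <= q' <= 1 - mu & `|q' - q| <= mu.
Proof.
move=> mu0 q01.
have [h1|h1] := ltP q mu.
  by exists mu; [lra|rewrite ger0_norm; lra].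
have [h2|h2] := ltP (1 - mu) q.
  by exists (1 - mu); [lra|rewrite ler0_norm; lra].
by exists q; [lra|rewrite subrr normr0; lra].
Qed.

Lemma truncn_near_mod4 (R : realType) (x theta mu : R) (n : nat) (A : int) :
  0 <= x -> mu <= theta <= 1 - mu -> `|x - (n%:R + theta) - 4 * A%:~R| < mu ->
  (Num.truncn x = n %[mod 4])%N /\ `|x - (Num.truncn x)%:R - theta| < mu.
Proof.
move=> x0 th /[dup] xA /ltr_normlP[h1 h2].
have /andP[m1 m2] := truncn_itv x0; rewrite -natr1 in m2.
have mE : (Num.truncn x)%:Z = n%:Z + 4 * A.
  apply/eqP; rewrite eq_le -!ltzD1 -!(ltr_int R) !rmorphD/= rmorphM/= -!pmulrn.
  by apply/andP; split; lra.
have -> : (Num.truncn x)%:R = n%:R + 4 * A%:~R :> R.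
  by rewrite pmulrn mE rmorphD/= rmorphM/= -!pmulrn.
split; first by move: mE; move: (Num.truncn x); clear; lia.
by rewrite (_ : x - (n%:R + 4 * A%:~R) - theta = x - (n%:R + theta) - 4 * A%:~R)//; ring.
Qed.

(* [px + d] and [py + (N + S^-1) * d] are the coordinates of the end of the
   line; they are prescribed modulo 4, up to [mu], together with the column of
   the last additional step. *)
Lemma steep_line_aim (R : realType) (px py c N mu : R) :
  0 <= px < 1 -> 0 <= py < 1 -> 0 <= c < 1 -> 1 <= N -> 0 < mu <= 4^-1 ->
  16 / N <= mu ->
  exists2 T0 : R, 0 < T0 & forall (T : R) (k u v : nat) (qx qy : R), T0 < T ->
  mu <= qx <= 1 - mu -> mu <= qy <= 1 - mu ->
  exists (S : R) (w : nat) (col : nat -> nat) (b s : nat),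
  let d := T / Num.sqrt (1 + (N + S^-1) ^+ 2) in
  let M := Num.truncn (px + d) in
  let K := Num.truncn (py + (N + S^-1) * d) in
  [/\ 1 <= S, 0 <= d,
      [/\ forall i, (i < (4 * w).+1)%N ->
            (col i)%:R < px + (1 - c + i%:R) * S < (col i).+1%:R,
          forall i, (i < 4 * w)%N -> (col i = b + 2 * s * i %[mod 4])%N &
          (col (4 * w) = k %[mod 4])%N],
      px + (1 - c + (4 * w)%:R) * S <= M%:R /\
      px + d < px + (1 - c + (4 * w).+1%:R) * S &
      [/\ (M = u %[mod 4])%N, `|px + d - M%:R - qx| < mu,
          (K = v %[mod 4])%N & `|py + (N + S^-1) * d - K%:R - qy| < mu]].
Proof.
move=> px01 py01 c01 N1 mu0 muN.
have N20 := sqr_ge0 N.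
have q0 : 0 < 1 + N ^+ 2 by rewrite ltr_pwDl.
pose l := Num.sqrt (1 + N ^+ 2); pose rho := 5 + 4 / (1 - c).
have l0 : 0 < l by rewrite sqrtr_gt0.
have c0 : 0 < 1 - c <= 1 by lra.
have rho1 : 1 <= rho.
  have : 0 <= 4 / (1 - c) by rewrite divr_ge0// ltW//; case/andP: c0.
  by rewrite /rho; lra.
pose Ym := 16 * (1 + N ^+ 2) + 2.
have Ym0 : 0 < Ym by rewrite /Ym; lra.
(* [Ym] bounds the later [Y] by the bound on [w] in [torus_step]. Beyond [T1] the error [eps] is at
   most [mu / 4]; beyond [T2] one has [S >= 8]. *)
pose T1 := 4 * (Ym ^+ 2 * (l * rho + 1)) / mu; pose T2 := 8 * (l * Ym).
have lrho0 : 0 < l * rho + 1.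
  by rewrite ltr_wpDl// mulr_ge0 ?(ltW l0)// (le_trans _ rho1).
have [mu_gt0 mu_le] := andP mu0.
have T10 : 0 < T1 by rewrite divr_gt0 ?mulr_gt0 ?exprn_gt0.
have T20 : 0 < T2 by rewrite !mulr_gt0.
exists (T1 + T2); first exact: addr_gt0.
move=> T k u v qx qy TT qx01 qy01.
have T1T : T1 < T by apply: le_lt_trans TT; rewrite lerDl ltW.
have T2T : T2 < T by apply: le_lt_trans TT; rewrite lerDr ltW.
have T0 : 0 < T := lt_trans T10 T1T.
have [w [A [B [w0 wle Ax By]]]] := @torus_step R N
  (px + (l * T - N * (3 / 2 - c)) / (1 + N ^+ 2))
  (py + (N * l * T + (3 / 2 - c)) / (1 + N ^+ 2))
  (u%:R + qx) (v%:R + qy) N1.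
(* In units of [S], midway between the additional steps [4 * w] and [4 * w + 1]; the line is to end
   about there. *)
pose Y := 4 * w%:R + 3 / 2 - c.
have w1 : (1 : R) <= w%:R by rewrite ler1n.
have Y0 : 0 < Y by move: w1 c01; rewrite /Y; clear; lra.
have YYm : Y <= Ym by move: wle c01; rewrite /Y /Ym; clear; lra.
have S10 : 0 < T / (l * Y) by rewrite divr_gt0// mulr_gt0.
have [S [col [b [s [S1 colP colmod colk]]]]] :=
  additional_steps k px01 c0 (ltW S10) w0.
exists S, w, col, b, s => d M K; rewrite -/rho in S1.
have := steep_vector_estimate N1 T0 Y0 rho1 S1.
rewrite /= -/l -/d; set eps := _ / T => -[dS dx dy].
have epsmu : eps <= mu / 4.
  rewrite /eps ler_pdivrMr//.
  have h1 : Y ^+ 2 * (l * rho + 1) <= Ym ^+ 2 * (l * rho + 1).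
    by rewrite ler_pM2r// ler_pXn2r// nnegrE ltW.
  have h2 : mu / 4 * T1 <= mu / 4 * T.
    by rewrite ler_pM2l ?(ltW T1T)// divr_gt0.
  apply: (le_trans h1); apply: le_trans h2; rewrite le_eqVlt; apply/orP; left.
  by rewrite /T1; apply/eqP; field; rewrite gt_eqF.
have S8 : 8 <= S.
  apply: le_trans (andP S1).1; rewrite ler_pdivlMr ?mulr_gt0//.
  by apply: le_trans (ltW T2T); rewrite ler_pM2l// ler_pM2l.
have S0 : 0 < S by apply: lt_le_trans S8.
have d0 : 0 < d by rewrite /d divr_gt0// sqrtr_gt0 ltr_pwDl// sqr_ge0.
have N4 : 4 / N <= mu / 4 by move: muN; clear; lra.
have N8 : 8 / N <= mu / 2 by move: muN; clear; lra.
have zx0 : 0 <= px + d by rewrite addr_ge0 ?(ltW d0)//; case/andP: px01.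
have zy0 : 0 <= py + (N + S^-1) * d.
  have kappa0 : 0 <= N + S^-1.
    by rewrite addr_ge0 ?invr_ge0 ?(ltW S0)// (le_trans _ N1).
  by case/andP: py01 => py0 _; exact: addr_ge0 py0 (mulr_ge0 kappa0 (ltW d0)).
have [Mmod MX] : (M = u %[mod 4])%N /\ `|px + d - M%:R - qx| < mu.
  apply: (@truncn_near_mod4 _ _ _ _ _ A) => //.
  have -> : px + d - (u%:R + qx) - 4 * A%:~R =
    (px + (l * T - N * (3 / 2 - c)) / (1 + N ^+ 2) -
      4 * w%:R * N / (1 + N ^+ 2) - (u%:R + qx) - 4 * A%:~R) +
    (d - (l * T - N * Y) / (1 + N ^+ 2)).
    by rewrite /Y; field; rewrite gt_eqF.
  apply: le_lt_trans (ler_normD _ _) _; apply: le_lt_trans (lerD Ax dx) _.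
  by move: N4 epsmu mu_gt0; clear; lra.
have [Kmod KY] : (K = v %[mod 4])%N /\
    `|py + (N + S^-1) * d - K%:R - qy| < mu.
  apply: (@truncn_near_mod4 _ (py + (N + S^-1) * d) qy mu v B) => //.
  have -> : py + (N + S^-1) * d - (v%:R + qy) - 4 * B%:~R =
    (py + (N * l * T + (3 / 2 - c)) / (1 + N ^+ 2) +
      4 * w%:R / (1 + N ^+ 2) - (v%:R + qy) - 4 * B%:~R) +
    ((N + S^-1) * d - (N * l * T + Y) / (1 + N ^+ 2)).
    by move: (_ * d) => nd; rewrite /Y; field; rewrite gt_eqF.
  apply: le_lt_trans (ler_normD _ _) _; apply: le_lt_trans (lerD By dy) _.
  by move: N8 epsmu mu_gt0; clear; lra.
have dYS : d = d / S * S by rewrite divfK// gt_eqF.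
split=> //; [by apply: le_trans S8; rewrite ler1n|exact: ltW|split].
(* The last additional step precedes the end by at least [S / 4 >= 2] columns, hence is made before
   column [M]. *)
- have h : (4 * w%:R + 1 - c + 4^-1) * S <= d.
    rewrite dYS ler_pM2r//; apply: le_trans (andP dS).1.
    by move: epsmu mu_le; rewrite /Y; clear; lra.
  have /andP[_] := truncn_itv zx0; rewrite -/M -natr1 natrM.
  by move: h S8; clear; lra.
- have : d <= Y * S by rewrite {1}dYS ler_pM2r//; case/andP: dS.
  by rewrite /Y -[(4 * w).+1%:R]natr1 natrM; move: S0; clear; lra.
Qed.

Theorem corollary2 (R : realType) (C : cube R) (P : 'rV[R]_3)
    (hP : surface C P) : wave_front_becomes_dense C P.
Proof.
move=> r r0; have L0 := side_gt0 C.
have [f0 [px [py [pf0 px01 py01 ->]]]] := surface_frame hP.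
(* Each coordinate will be off by at most [2 * mu], so the distance is at most [4 * side C * mu],
   which is below [r]. *)
pose mu := Num.min (4^-1) (r / (8 * side C)).
have mu0 : 0 < mu <= 4^-1.
  by rewrite /mu ge_min lexx lt_min invr_gt0 divr_gt0 ?mulr_gt0 ?ltr0n.
have mur : 8 * side C * mu <= r.
  by rewrite mulrC -ler_pdivlMr ?mulr_gt0// /mu ge_min lexx orbT.
pose N0 := (Num.truncn (16 / mu)).+1; pose N : R := (4 * N0)%:R.
have muN : 16 / N <= mu.
  have := truncnS_gt (16 / mu); rewrite -/N0 => h.
  have N00 : 0 < N by rewrite ltr0n.
  rewrite ler_pdivrMr// mulrC -ler_pdivrMr; last by case/andP: mu0.
  by rewrite (le_trans (ltW h))// /N ler_nat leq_pmull.
have N1 : 1 <= N by rewrite ler1n.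
(* The line of slope [N] through the starting point has height [py - N * px] at abscissa 0; [e] is
   the residue modulo 4 of its integer part. *)
pose z0 := Num.floor (py - N * px).
pose e := `|(z0 %% 4)%Z|%N; pose z := (z0 %/ 4)%Z.
have z0E : z0 = e%:Z + 4 * z.
  by rewrite {1}(divz_eq z0 4) /e gez0_abs ?modz_ge0// addrC mulrC.
pose c := py - N * px - z0%:~R.
have c01 : 0 <= c < 1.
  by have := floor_itv (py - N * px); rewrite rmorphD/= -/z0 /c; lra.
have cE : py - N * px = e%:R + 4 * z%:~R + c.
  by rewrite /c z0E rmorphD/= rmorphM/= -pmulrn; ring.
have [T0 T00 aim] := steep_line_aim px01 py01 c01 N1 mu0 muN.
exists (side C * T0); split; first exact: mulr_gt0.
move=> t tT q [F qF].
have t0 : 0 < t by apply: lt_trans tT; exact: mulr_gt0.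
have TT : T0 < t / side C by rewrite ltr_pdivlMr// mulrC.
have [k [j kjF]] := face_reached F (proper_iter_up e pf0).
set g := iter j _ _ in kjF.
have pg : proper_frame g.
  exact/proper_iter_right/proper_roll_up/proper_iter_right/proper_iter_up.
rewrite -kjF in qF; have [qx [qy [qx01 qy01 ->]]] := face_frame pg qF.
have [qx' qx'01 qx'E] := clamp_unit mu0 qx01.
have [qy' qy'01 qy'E] := clamp_unit mu0 qy01.
(* The last additional step is made in a column congruent to [k], and [j] more steps to the right
   lead to the final column. The row is [e + 1] modulo 4 because there are [4 * w + 1] additional
   steps. *)
have := aim _ k (k + j)%N e.+1 qx' qy' TT qx'01 qy'01.
move=> [S [w [col [b [s]]]]] /=.
set d := t / _ / _; set M := Num.truncn (px + d); set K := Num.truncn _.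
move=> [S1 d0 [colP colmod colk] [lastM lastd] [Mmod MX Kmod KY]].
have S0 : 0 < S by exact: lt_le_trans S1.
have kappa0 : 0 < N + S^-1 by rewrite addr_gt0 ?invr_gt0// (lt_le_trans _ N1).
have dE : d = t / (side C * Num.sqrt (1 + (N + S^-1) ^+ 2)).
  by rewrite invfM mulrA.
have MX' : M%:R <= px + d < M.+1%:R.
  by apply: truncn_itv; rewrite addr_ge0//; case/andP: px01.
have KY' : K%:R <= py + (N + S^-1) * d < K.+1%:R.
  case/andP: py01 => py0 _; apply: truncn_itv.
  exact: addr_ge0 py0 (mulr_ge0 (ltW kappa0) d0).
exists (fold_point C g (px + d - M%:R) (py + (N + S^-1) * d - K%:R)); split.
  have -> : g = iter M roll_right
      (conjugated_ups col (iter e roll_up f0) (4 * w).+1).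
    rewrite /= (conjugated_ups_cancel _ colmod) (conjugated_up_mod _ colk).
    rewrite /conjugated_up -iterD (@iter_right_mod (M + 3 * k) j)//.
    by move: Mmod; clear; lia.
  have := @wave_front_steep_line R C t px py c S z N0 e (4 * w).+1 M K col f0.
  cbv zeta; rewrite -/N -dE; apply=> //.
  by move: Kmod; clear; lia.
apply: fold_point_in_ball => //.
- by move: MX'; rewrite -natr1; clear; lra.
- by move: KY'; rewrite -natr1; clear; lra.
have h1 : `|px + d - M%:R - qx| <= mu + mu.
  rewrite (_ : _ - qx = (px + d - M%:R - qx') + (qx' - qx)); last by ring.
  exact: le_trans (ler_normD _ _) (lerD (ltW MX) qx'E).
have h2 : `|py + (N + S^-1) * d - K%:R - qy| <= mu + mu.
  rewrite (_ : _ - qy =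
    (py + (N + S^-1) * d - K%:R - qy') + (qy' - qy)); last by ring.
  exact: le_trans (ler_normD _ _) (lerD (ltW KY) qy'E).
have h3 : 0 < side C * mu by rewrite mulr_gt0//; case/andP: mu0.
have h4 := lerD h1 h2; rewrite -(ler_pM2l L0) in h4.
by apply: le_lt_trans h4 _; move: h3 mur; clear; lra.
Qed.
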